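(* Every three-distance set $X\subset\mathbb{R}^3$ with $|X|=12$ contains a five-point subset that is a two-distance set.
   Context: For $X\subset\mathbb{R}^d$, let $A(X)=\{PQ \mid P,Q\in X,\ P\neq Q\}$, where $PQ$ denotes the Euclidean distance between $P$ and $Q$. The set $X$ is called a $k$-distance set if $|A(X)|=k$ (exactly $k$ distinct distances occur). *)

(* Defs.v *)
From mathcomp Require Import all_boot all_order all_algebra.
From mathcomp Require Import boolp classical_sets functions cardinality reals.

Set Implicit Arguments.
Unset Strict Implicit.
Unset Printing Implicit Defensive.

Local Open Scope ring_scope.
Local Open Scope classical_set_scope.
Local Open Scope card_scope.

(* The library's canonical norm on 'rV[R]_d is the sup norm, hence
   an explicit Euclidean distance. *)
Definition edist (R : realType) (d : nat) (P Q : 'rV[R]_d) : R :=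
  Num.sqrt (\sum_(i < d) (P ord0 i - Q ord0 i) ^+ 2).

Definition distances (R : realType) (d : nat) (X : set 'rV[R]_d) : set R :=
  [set r | exists P Q, [/\ X P, X Q, P <> Q & r = edist P Q]].

Definition distance_set (R : realType) (d k : nat) (X : set 'rV[R]_d) : Prop :=
  distances X #= `I_k.

(* Main.v *)
From mathcomp Require Import all_boot all_order all_algebra.
From mathcomp Require Import boolp classical_sets functions cardinality reals.
From mathcomp Require Import set_interval topology normedtype derive.
From mathcomp Require Import ring lra zify.
Require Import Defs.
Import Order.TTheory GRing.Theory Num.Theory.
Import numFieldNormedType.Exports.

Set Implicit Arguments.
Unset Strict Implicit.
Unset Printing Implicit Defensive.

(** It suffices to find five points no two of which are at the largest distance:
    they determine at most two distances, and not one, since R^3 contains no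
    five equidistant points.

    In the graph of the pairs at largest distance 1, two closed odd walks share
    a vertex (Dol'nikov; the proof follows Swanepoel). For a closed odd walk
    (x_i), the vectors (-1)^i (x_(i+1) - x_i) are the vertices of a closed
    antipodal polygon on the sphere, and two such polygons cross, both being
    noncontractible curves of the projective plane; but elementary inequalities
    show that arcs which come from distinct points x_i, y_j with distinct
    neighbours never meet.

    Hence for each set A of vertices either A or its complement spans a
    bipartite graph, and a graph on 12 vertices with this property has an
    independent set of size 5: otherwise it is triangle-free with all degrees 3
    or 4, and around a vertex v of degree 4 the 7 vertices at distance at least
    2 from v span a graph which can neither contain a pentagon nor be
    2-regular. *)

(** * Graphs without disjoint odd cycles *)

Section FiniteGraphs.
Import fintype boot.finset.

Definition bipartite (V : finType) (e : rel V) (A : {set V}) : Prop :=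
  exists c : V -> bool, {in A &, forall x y, e x y -> c x != c y}.

Definition indep (V : finType) (e : rel V) (S : {set V}) : Prop :=
  {in S &, forall x y, ~~ e x y}.

(** [E] is the bipartite double cover of the graph on [A]. A path in it joining the two lifts of a
    vertex projects to a closed walk of odd length, extended periodically; if no two such lifts are
    connected, the components give a 2-colouring. *)
Lemma odd_closed_walk (V : finType) (e : rel V) (A : {set V}) :
  symmetric e -> ~ bipartite e A ->
  exists (a : nat -> V) (m : nat), odd m /\
    forall i, [/\ a i \in A, e (a i) (a i.+1) & a (i + m) = a i].
Proof.
move=> esym nbip.
pose E := [rel x y : V * bool |
  [&& x.1 \in A, y.1 \in A, e x.1 y.1 & x.2 != y.2]].
have Esym : symmetric E.
  by move=> [x b] [y c] /=; rewrite esym eq_sym andbCA.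
have cE := sym_connect_sym Esym.
have [x xA xE] : exists2 x, x \in A & connect E (x, false) (x, true).
  case: (boolP [exists x in A, connect E (x, false) (x, true)]).
    by case/exists_inP => x; exists x.
  rewrite negb_exists_in => /forall_inP noE; case: nbip.
  (* An edge exchanges the roots of the two lifts, so comparing these roots in any total order
     colours its ends differently; [enum_rank] supplies the order. *)
  pose r (x : V) (b : bool) := enum_rank (fingraph.root E (x, b)).
  exists (fun x => r x false < r x true) => x y xA yA exy.
  have rE b : r x b = r y (~~ b).
    by congr enum_rank; apply/(fingraph.rootP cE)/connect1 => /=; rewrite xA yA exy; case: b.
  have rN : r y false != r y true.
    by apply: contra (noE y yA) => /eqP /enum_rank_inj /(fingraph.rootP cE).
  by rewrite !rE /= ltnNge leq_eqVlt (inj_eq val_inj) (negPf rN); case: (_ < _).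
case/connectP: xE => p pE lastE.
pose q i := nth (x, false) ((x, false) :: p) i.
have qE i : i < size p -> E (q i) (q i.+1) by move/(pathP (x, false)): pE; apply.
have qodd i : i <= size p -> (q i).2 = odd i.
  elim: i => [|i IH] //= ip; have := qE i ip; rewrite /E /= => /and4P[_ _ _].
  by rewrite (IH (ltnW ip)); case: (odd i); case: (_.2).
have qlast : q (size p) = (x, true) by rewrite /q -last_nth -lastE.
have podd : odd (size p) by rewrite -qodd // qlast.
have p0 : 0 < size p by case: (size p) podd.
exists (fun i => (q (i %% size p)).1), (size p); split=> // i.
have /qE := ltn_pmod i p0; rewrite /E /= => /and4P[-> _ eq _]; split=> //; last first.
  by rewrite modnDr.
have [lt|] := ltnP (i %% size p).+1 (size p).
  by rewrite -(modn_small lt) -addn1 modnDml addn1 in eq.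
(* On the last edge the walk closes up: the path ends in [(x, true)], which projects to the starting
   vertex. *)
move: (ltn_pmod i p0) => lt1 lt2.
have e1 : (i %% size p).+1 = size p by apply/eqP; rewrite eqn_leq lt1 lt2.
have -> : i.+1 %% size p = 0 by rewrite -addn1 -modnDml addn1 e1 modnn.
by move: eq; rewrite e1 qlast.
Qed.

Lemma bipartite_indep (V : finType) (e : rel V) (A : {set V}) :
  bipartite e A ->
  exists S : {set V}, [/\ S \subset A, indep e S & #|A| <= 2 * #|S|].
Proof.
case=> c cP.
pose B b := [set x in A | c x == b].
have BA b : B b \subset A by apply/subsetP => x; rewrite inE => /andP[].
have Bind b : indep e (B b).
  move=> x y; rewrite !inE => /andP[xA /eqP cx] /andP[yA /eqP cy].
  by apply/negP => /(cP _ _ xA yA); rewrite cx cy eqxx.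
have AE : #|A| = #|B true| + #|B false|.
  rewrite -cardsUI (_ : _ :&: _ = set0) ?cards0 ?addn0.
    by apply: eq_card => x; rewrite !inE; case: (c x); case: (_ \in _).
  by apply/setP => x; rewrite !inE; case: (c x); case: (_ \in _).
have [l|l] := leqP #|B true| #|B false|.
  by exists (B false); split => //; lia.
by exists (B true); split => //; lia.
Qed.

Section Graph.
Variables (V : finType) (e : rel V).
Hypothesis esym : symmetric e.
Hypothesis eirr : irreflexive e.
Local Notation N := (fun x => [set y | e x y]).

Lemma indepU1 x (S : {set V}) :
  {in S, forall y, ~~ e x y} -> indep e S -> indep e (x |: S).
Proof.
move=> xS iS y z; rewrite !inE => /orP[/eqP ->|yS] /orP[/eqP ->|zS].
- by rewrite eirr.
- exact: xS.
- by rewrite esym xS.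
- exact: iS.
Qed.

Lemma indepS (S T : {set V}) : S \subset T -> indep e T -> indep e S.
Proof. by move=> /subsetP sub iT x y /sub xT /sub yT; apply: iT. Qed.

Lemma not_indep (S : {set V}) : ~ indep e S ->
  exists x y, [/\ x \in S, y \in S & e x y].
Proof.
move=> nS; case: (boolP [exists x in S, exists y in S, e x y]).
  by case/exists_inP => x xS /exists_inP[y yS exy]; exists x, y.
rewrite negb_exists_in => /forall_inP h; case: nS => x y xS yS.
by move: (h x xS); rewrite negb_exists_in => /forall_inP; apply.
Qed.

Lemma bipartite_triangle x y z A : bipartite e A ->
  x \in A -> y \in A -> z \in A -> e x y -> e y z -> e x z -> False.
Proof.
case=> c cP xA yA zA /(cP _ _ xA yA) + /(cP _ _ yA zA) + /(cP _ _ xA zA).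
by case: (c x); case: (c y); case: (c z).
Qed.

Lemma bipartite_pentagon a b c d f A : bipartite e A ->
  a \in A -> b \in A -> c \in A -> d \in A -> f \in A ->
  e a b -> e b c -> e c d -> e d f -> e f a -> False.
Proof.
case=> k kP aA bA cA dA fA /(kP _ _ aA bA) + /(kP _ _ bA cA) + /(kP _ _ cA dA)
  + /(kP _ _ dA fA) + /(kP _ _ fA aA).
by case: (k a); case: (k b); case: (k c); case: (k d); case: (k f).
Qed.

(** * Graphs on 12 vertices without an independent set of size 5 *)

Section Extremal.
Hypothesis V12 : #|V| = 12.
Hypothesis alpha4 : forall S : {set V}, indep e S -> #|S| <= 4.
Hypothesis bipC : forall A : {set V}, bipartite e A \/ bipartite e (~: A).

Lemma indep_seq_le4 (s : seq V) :
  uniq s -> pairwise (fun x y => ~~ e x y) s -> size s <= 4.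
Proof.
move=> us ps; have {us} <- : #|[set x in s]| = size s.
  by rewrite cardsE; apply/card_uniqP.
apply: alpha4; elim: s ps => [|x s IH] /=; first by move=> _ x y; rewrite inE.
case/andP => /allP xs /IH iS; rewrite set_cons.
by apply: indepU1 => // y; rewrite inE => /xs.
Qed.

(** Otherwise the complement of the triangle is bipartite; it has at least 9 vertices, so one colour
    class is an independent set of size 5. *)
Lemma no_triangle x y z : e x y -> e y z -> e x z -> False.
Proof.
move=> xy yz xz; case: (bipC [set x; y; z]) => [b|/bipartite_indep[S [_ /alpha4 S4]]].
  by apply: (bipartite_triangle b _ _ _ xy yz xz); rewrite !inE eqxx ?orbT.
have := cardsC [set x; y; z]; have := cardsU [set x; y] [set z].
by rewrite cards2 cards1 V12; lia.
Qed.

Lemma indep_nbrs x : indep e (N x).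
Proof.
move=> y z; rewrite !inE => xy xz; apply/negP => yz; exact: no_triangle xy yz xz.
Qed.

Lemma deg_le4 x : #|N x| <= 4.
Proof. exact: alpha4 (@indep_nbrs x). Qed.

(* R(3,3) = 6 *)
Lemma indep3 (A : {set V}) : 6 <= #|A| ->
  exists S : {set V}, [/\ S \subset A, indep e S & 3 <= #|S|].
Proof.
move=> A6; have [k kA] : exists k, k \in A by apply/card_gt0P; apply: leq_trans A6.
have := cardsD1 k A; rewrite kA.
rewrite -(cardsID (N k) (A :\ k)) => cA.
have [l|l] := leqP 3 #|(A :\ k) :&: N k|.
  exists ((A :\ k) :&: N k); split => //.
    by apply/subsetP => y; rewrite !inE => /andP[/andP[]].
  by apply: indepS (@indep_nbrs k); rewrite subsetIr.
set B := A :\ k :\: N k in cA.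
have B3 : 3 <= #|B| by lia.
have nB : ~ forall x y, x \in B -> y \in B -> x != y -> e x y.
  move=> hB; have /card_gt0P : 0 < #|B| by lia.
  case=> x xB; have := cardsD1 x B; rewrite xB => cB.
  have /card_gt0P : 0 < #|B :\ x| by lia.
  case=> y yB; have := cardsD1 y (B :\ x); rewrite yB => cB'.
  have /card_gt0P : 0 < #|B :\ x :\ y| by lia.
  case=> z; move: yB; rewrite !in_setD1 => /andP[yx yB] /and3P[zy zx zB].
  by apply: (@no_triangle x y z); apply: hB => //; rewrite eq_sym.
have [x [y [xB yB xy nxy]]] : exists x y, [/\ x \in B, y \in B, x != y & ~~ e x y].
  case: (boolP [exists x in B, exists y in B, (x != y) && ~~ e x y]).
    by case/exists_inP => x xB /exists_inP[y yB /andP[? ?]]; exists x, y.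
  rewrite negb_exists_in => /forall_inP h; case: nB => x y xB yB xy.
  move: (h x xB); rewrite negb_exists_in => /forall_inP /(_ y yB).
  by rewrite xy negbK.
move: xB yB; rewrite !inE => /and3P[kx xk xA] /and3P[ky yk yA].
exists (k |: [set x; y]); split.
- by apply/subsetP => z; rewrite !inE => /or3P[] /eqP ->.
- apply: indepU1 => [z|].
    by rewrite !inE => /orP[] /eqP ->.
  move=> z t; rewrite !inE => /orP[] /eqP -> /orP[] /eqP ->; rewrite ?eirr //.
  by rewrite esym.
- by rewrite cardsU1 !inE cards2 xy negb_or eq_sym xk eq_sym yk.
Qed.

(** Both [u] and [v] can be added to [T]. *)
Lemma indep_far u v (T : {set V}) : u != v -> ~~ e u v ->
  T \subset ~: ([set u; v] :|: (N u :|: N v)) -> indep e T -> #|T| <= 2.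
Proof.
move=> uv nuv /subsetP sub iT.
have nu : u \notin T by apply/negP => /sub; rewrite !inE eqxx.
have nv : v \notin T by apply/negP => /sub; rewrite !inE eqxx orbT.
have /alpha4 : indep e (u |: (v |: T)).
  apply: indepU1 => [z|]; last apply: indepU1 => [z /sub|] //.
    rewrite inE => /orP[|/sub]; first by rewrite inE => /eqP ->.
    by rewrite !inE !negb_or => /and3P[_ ].
  by rewrite !inE !negb_or => /and3P[_ ].
by rewrite !cardsU1 !inE negb_or uv nu nv.
Qed.


(** If the union has at most 5 elements, the set [K] of vertices far from [u] and [v] has at least
    5, but no independent triple by [indep_far]. So [K] is not bipartite, and [R(3,3) = 6] leaves
    only [#|K| = 5]. Then the union has 5 elements and contains an edge, which closes a pentagon
    through [u], [c], [v] outside [K], although the complement of [K] is bipartite. *)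
Lemma nbrs_union_ge6 u v c : u != v -> e c u -> e c v -> 6 <= #|N u :|: N v|.
Proof.
move=> uv cu cv; have nuv : ~~ e u v.
  by apply/negP => euv; apply: no_triangle cu euv cv.
rewrite leqNgt; apply/negP; rewrite ltnS => le5.
set K := ~: ([set u; v] :|: (N u :|: N v)).
have cK : 5 <= #|K| /\ (#|K| <= 5 -> 5 <= #|N u :|: N v|).
  have := cardsC ([set u; v] :|: (N u :|: N v)).
  by rewrite cardsU cards2 uv V12 -/K; split; lia.
have K2 (T : {set V}) : T \subset K -> indep e T -> #|T| <= 2 by apply: indep_far.
have [bK|bK] := bipC K.
  by have [S [SK /(K2 _ SK) S2 KS]] := bipartite_indep bK; lia.
have [l|l] := leqP 6 #|K|.
  by have [S [SK /(K2 _ SK) S2 KS]] := indep3 l; lia.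
have W5 : 5 <= #|N u :|: N v| by apply: cK.2.
have [|a [b [aW bW ab]]] := @not_indep (N u :|: N v).
  by move=> /alpha4; lia.
have pent a' b' : e u a' -> e v b' -> e a' b' -> False.
  move=> ua vb a'b'.
  apply: (bipartite_pentagon (a:=u) (b:=a') (c:=b') (d:=v) (f:=c) bK);
    rewrite ?inE ?negbK ?inE ?eqxx ?ua ?vb ?orbT //=.
  - by rewrite (esym u) cu ?orbT.
  - by rewrite esym.
  - by rewrite esym.
move: aW bW; rewrite !inE => /orP[ua|va] /orP[ub|vb].
- exact: no_triangle ua ab ub.
- exact: pent ua vb ab.
- by apply: pent ub va _; rewrite esym.
- exact: no_triangle va ab vb.
Qed.

Lemma deg_pair_ge7 c u v : u != v -> e c u -> e c v -> 7 <= #|N u| + #|N v|.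
Proof.
move=> uv cu cv; have := nbrs_union_ge6 uv cu cv.
suff : 0 < #|N u :&: N v| by rewrite cardsU; lia.
by apply/card_gt0P; exists c; rewrite !inE !(esym _ c) cu.
Qed.

(** If [v] had degree at most 1 and [h] were a non-neighbour, then [v], [h] and their neighbours
    would number at most 2 + 1 + 3; the other 6 vertices would contain an independent triple,
    against [indep_far]. *)
Lemma deg_ge2 v : 2 <= #|N v|.
Proof.
rewrite leqNgt; apply/negP; rewrite ltnS => le1.
have vN : v \notin N v by rewrite inE eirr.
have /card_gt0P[h] : 0 < #|~: (v |: N v)|.
  by have := cardsC (v |: N v); rewrite cardsU1 vN V12; lia.
rewrite !inE negb_or => /andP[hv nvh].
have hN : h \notin N h by rewrite inE eirr.
have cNh : #|N h :\: N v| <= 3.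
  have /alpha4 : indep e (v |: (N h :\: N v)).
    apply: indepU1 => [y|]; first by rewrite !inE => /andP[].
    by apply: indepS (@indep_nbrs h); rewrite subsetDl.
  by rewrite cardsU1 !inE (esym h) (negPf nvh) andbF /=; lia.
have [S [SK iS S3]] : exists S : {set V},
    [/\ S \subset ~: ([set v; h] :|: (N v :|: N h)), indep e S & 3 <= #|S|].
  apply: indep3.
  have -> : N v :|: N h = N v :|: (N h :\: N v).
    by apply/setP => x; rewrite !inE; case: (e v x).
  have := cardsC ([set v; h] :|: (N v :|: (N h :\: N v))).
  rewrite cardsU cards2 (cardsU (N v)) V12 (eq_sym v) hv; lia.
have := indep_far _ nvh SK iS; rewrite eq_sym => /(_ hv); lia.
Qed.

Lemma deg_ge3 v : 3 <= #|N v|.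
Proof.
have /card_gt0P[u] : 0 < #|N v| by have := deg_ge2 v; lia.
rewrite inE => vu.
have /card_gt0P[w] : 0 < #|N u :\ v|.
  by have := cardsD1 v (N u); have := deg_ge2 u; rewrite inE esym vu; lia.
rewrite !inE => /andP[wv uw].
by have := deg_pair_ge7 wv uw; rewrite esym => /(_ vu); have := deg_le4 w; lia.
Qed.

Lemma deg3_nbr_uniq c u v : e c u -> e c v -> #|N u| = 3 -> #|N v| = 3 -> u = v.
Proof.
move=> cu cv du dv; apply/eqP/negPn/negP => uv.
by have := deg_pair_ge7 uv cu cv; lia.
Qed.

(** Two neighbours of a vertex of degree 3 cannot both have degree 3. The final count needs a vertex
    of degree 4 placed next to one of degree 3 whenever the latter exists. *)
Lemma deg4_near_deg3 :
  exists v, #|N v| = 4 /\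
    ((exists s, #|N s| = 3) -> exists2 s, e v s & #|N s| = 3).
Proof.
case: (boolP [exists s, #|N s| == 3]) => [/existsP[s /eqP ds]|].
  have /card_gt0P[a] : 0 < #|N s| by lia.
  rewrite inE => sa.
  have /card_gt0P[b] : 0 < #|N s :\ a|.
    by have := cardsD1 a (N s); rewrite inE sa; lia.
  rewrite !inE => /andP[ba sb].
  have := deg_pair_ge7 ba sb sa; have := deg_le4 a; have := deg_le4 b.
  have := deg_ge3 a; have := deg_ge3 b.
  have [/eqP da|da] := boolP (#|N a| == 4).
    by exists a; split => //; exists s; rewrite // esym.
  by exists b; split; [lia|exists s; rewrite // esym].
rewrite negb_exists => /forallP no3.
have /card_gt0P[v _] : 0 < #|V| by rewrite V12.
exists v; split; last by case=> s /eqP; rewrite (negPf (no3 s)).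
by have := deg_le4 v; have := deg_ge3 v; have := no3 v; lia.
Qed.

(** * The graph on the 7 vertices not adjacent to a vertex of degree 4 *)

Section Core.
Variable v : V.
Hypothesis dv : #|N v| = 4.
Hypothesis vS : (exists s, #|N s| = 3) -> exists2 s, e v s & #|N s| = 3.
Let H := ~: (v |: N v).

Lemma mem_H x : (x \in H) = (x != v) && ~~ e v x.
Proof. by rewrite !inE negb_or. Qed.

Lemma card_H : #|H| = 7.
Proof.
by have := cardsC (v |: N v); rewrite cardsU1 inE eirr V12 -/H; lia.
Qed.

Definition dH x := #|N x :&: H|.

(** Without a common neighbour with [v], all neighbours of [h], at least 3, lie in [H]. With one,
    the at least 6 neighbours of [v] or [h] include only 4 of [v]. *)
Lemma dH_ge2 h : h \in H -> 2 <= dH h.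
Proof.
rewrite mem_H => /andP[hv vh].
have -> : dH h = #|N h :\: N v|.
  apply: eq_card => x; rewrite !inE; case hx: (e h x); rewrite ?andbF //= andbT.
  rewrite (_ : x == v = false) //; apply/eqP => xv.
  by move: hx; rewrite xv esym (negPf vh).
have [/eqP e0|/set0Pn[c]] := boolP (N v :&: N h == set0).
  have := cardsID (N v) (N h); rewrite setIC e0 cards0.
  by have := deg_ge3 h; lia.
rewrite !inE => /andP[vc hc].
have := nbrs_union_ge6 hv; rewrite (_ : N h :|: N v = N v :|: (N h :\: N v)).
  by move=> /(_ c); rewrite !(esym c) hc vc cardsU dv => /(_ isT isT); lia.
by apply/setP => x; rewrite !inE; case: (e v x); rewrite ?orbT ?orbF.
Qed.

Lemma indep_H (T : {set V}) : T \subset H -> indep e T -> #|T| <= 3.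
Proof.
move=> /subsetP TH iT.
have /alpha4 : indep e (v |: T).
  by apply: indepU1 => // y /TH; rewrite mem_H => /andP[].
by rewrite cardsU1; case: (boolP (v \in T)) => [/TH|_]; [rewrite mem_H eqxx|lia].
Qed.

Lemma dH_le3 h : dH h <= 3.
Proof.
by apply: indep_H; [exact: subsetIr|apply: indepS (@indep_nbrs h); exact: subsetIl].
Qed.

Lemma sum_nbrs_setI (A B : {set V}) :
  \sum_(x in A) #|N x :&: B| = \sum_(y in B) #|N y :&: A|.
Proof.
have E (P Q : {set V}) : \sum_(x in P) #|N x :&: Q| =
    \sum_(x in P) \sum_(y in Q) e x y.
  apply: eq_bigr => x _; rewrite -sum1_card big_mkcond [RHS]big_mkcond /=.
  by apply: eq_bigr => y _; rewrite !inE; case: (e x y); case: (y \in Q).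
rewrite !E exchange_big; apply: eq_bigr => y _; apply: eq_bigr => x _.
by rewrite esym.
Qed.

(** The edges between [N v] and [H] are counted from both sides; the 4 accounts for the edges at
    [v], and [N v] is independent. *)
Lemma sum_dH : \sum_(h in H) dH h + \sum_(a in N v) #|N a| = \sum_(h in H) #|N h| + 4.
Proof.
have -> : \sum_(a in N v) #|N a| = \sum_(h in H) #|N h :&: N v| + 4.
  rewrite sum_nbrs_setI -[in RHS]dv -[#|N v| in RHS]sum1_card -big_split.
  apply: eq_bigr => a; rewrite inE => va; have := cardsD1 v (N a).
  rewrite inE esym va addnC => ->; congr (_ + _); apply: eq_card => x.
  rewrite !inE negb_or; case ax: (e a x); rewrite ?andbF //= andbT.
  case: (x == v) => //=; symmetry; apply/negP => vx; exact: no_triangle va ax vx.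
rewrite addnA -big_split /=; congr (_ + _); apply: eq_bigr => h; rewrite mem_H => /andP[hv vh].
rewrite -(cardsID (N v) (N h)) addnC; congr (_ + _); apply: eq_card => x.
rewrite !inE negb_or; case hx: (e h x); rewrite ?andbF //= andbT.
by case: eqP hx => // ->; rewrite esym (negPf vh).
Qed.

(** At most one of the four neighbours of [v] has degree 3, the others have degree 4. *)
Lemma sum_deg_nbrs_ge15 : 15 <= \sum_(a in N v) #|N a|.
Proof.
have d4 a : 3 <= #|N a| <= 4 by rewrite deg_ge3 deg_le4.
have [|] := boolP [exists s in N v, #|N s| == 3].
  case/exists_inP => s sv /eqP ds; rewrite (big_setD1 s sv) /= ds.
  suff : \sum_(i in N v :\ s) 4 <= \sum_(i in N v :\ s) #|N i|.
    by rewrite sum_nat_const; have := cardsD1 s (N v); rewrite sv dv; lia.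
  apply: leq_sum => x; rewrite in_setD1 => /andP[xs xv]; have := d4 x.
  suff : #|N x| != 3 by lia.
  apply: contra xs => /eqP dx; apply/eqP; move: xv sv; rewrite !inE => xv sv.
  exact: (deg3_nbr_uniq xv sv).
rewrite negb_exists_in => /forall_inP no3.
suff : \sum_(i in N v) 4 <= \sum_(i in N v) #|N i| by rewrite sum_nat_const dv; lia.
by apply: leq_sum => x /no3; have := d4 x; lia.
Qed.

(** By [sum_dH] the sum is at most 3 + 6 * 4 + 4 - 15. *)
Lemma sum_dH_le16 s : s \in H -> #|N s| = 3 -> \sum_(h in H) dH h <= 16.
Proof.
move=> sH ds; have := sum_dH; have := sum_deg_nbrs_ge15.
rewrite [X in _ = X + _](big_setD1 s sH) /= ds.
suff : \sum_(i in H :\ s) #|N i| <= \sum_(i in H :\ s) 4.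
  by rewrite sum_nat_const; have := cardsD1 s H; rewrite sH card_H; lia.
by apply: leq_sum => x _; apply: deg_le4.
Qed.

Lemma H_enum (s : seq V) : uniq s -> {subset s <= H} -> size s = 7 -> H =i s.
Proof.
move=> us sH s7 x; rewrite -mem_enum.
have sE : {subset s <= enum H} by move=> y /sH; rewrite mem_enum.
by have [|_ ->] := uniq_min_size us sE; rewrite // -cardE card_H s7.
Qed.

Lemma sum_H_enum (s : seq V) (F : V -> nat) :
  uniq s -> {subset s <= H} -> size s = 7 -> \sum_(x in H) F x = \sum_(x <- s) F x.
Proof.
move=> us sH s7; rewrite big_uniq //; apply: eq_bigl => x.
exact: (H_enum us sH s7 x).
Qed.

Lemma dH_enum (s : seq V) x :
  uniq s -> {subset s <= H} -> size s = 7 -> dH x = \sum_(y <- s) e x y.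
Proof.
move=> us sH s7; rewrite -(sum_H_enum _ us sH s7) /dH -sum1_card.
rewrite big_mkcond [RHS]big_mkcond /=.
by apply: eq_bigr => y _; rewrite !inE; case: (e x y); case: (_ || _).
Qed.

(* If [h1] had no neighbour in [N v], it would have degree 3, forcing too many
   edges in [H]; otherwise [v] closes up [h1 h2] to a second pentagon. *)
Lemma pentagon_rest_nonadj c0 c1 c2 c3 c4 h1 h2 :
  uniq [:: c0; c1; c2; c3; c4; h1; h2] ->
  {subset [:: c0; c1; c2; c3; c4; h1; h2] <= H} ->
  e c0 c1 -> e c1 c2 -> e c2 c3 -> e c3 c4 -> e c4 c0 -> ~~ e h1 h2.
Proof.
move=> u sH e01 e12 e23 e34 e40; apply/negP => eh.
have sumE := sum_H_enum dH u sH erefl; have dHE x := dH_enum x u sH erefl.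
have d2 x : x \in [:: c0; c1; c2; c3; c4; h1; h2] -> 2 <= dH x.
  by move=> /sH /dH_ge2.
have noN k1 : k1 \in [:: h1; h2] -> exists2 a, e v a & e k1 a.
  move=> k1h; case: (boolP [exists a, e v a && e k1 a]).
    by case/existsP => a /andP[]; exists a.
  rewrite negb_exists => /forallP noa; exfalso.
  have k1H : k1 \in H.
    by apply: sH; move: k1h; rewrite !inE => /orP[] ->; rewrite !orbT.
  have NH : N k1 :&: H = N k1.
    apply/setP => x; rewrite !inE; case kx: (e k1 x) => //=.
    have := noa x; rewrite kx andbT => /negPf ->; rewrite orbF.
    apply/eqP => xv; move: k1H; rewrite mem_H => /andP[_].
    by rewrite -xv esym kx.
  have dk : dH k1 = 3 by have := dH_le3 k1; have := deg_ge3 k1; rewrite /dH NH; lia.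
  (* Two of the three neighbours of [k1] lie on the pentagon. So the pentagon contributes at least
     10 + 2, [k1] contributes 3 and the other vertex at least 2: more than 16. *)
  have := sum_dH_le16 k1H; rewrite -NH => /(_ dk); rewrite sumE !big_cons big_nil.
  have := d2 h1; have := d2 h2; rewrite !inE !eqxx !orbT => /(_ isT) + /(_ isT).
  rewrite (dHE c0) (dHE c1) (dHE c2) (dHE c3) (dHE c4) !big_cons !big_nil.
  rewrite e01 e12 e23 e34 e40 (esym c1 c0) (esym c2 c1) (esym c3 c2) (esym c4 c3).
  rewrite (esym c0 c4) e01 e12 e23 e34 e40.
  move: k1h dk; rewrite !inE => /orP[] /eqP -> dk; rewrite dk;
    have := dk; rewrite dHE !big_cons big_nil ?eh ?eirr ?(esym h2 h1) ?eh;
    rewrite ?(esym _ h1) ?(esym _ h2);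
    repeat match goal with |- context [nat_of_bool (e ?x ?y)] =>
      generalize (nat_of_bool (e x y)) => ? end; lia.
have [a1 va1 ha1] : exists2 a, e v a & e h1 a by apply: noN; rewrite !inE eqxx.
have [a2 va2 ha2] : exists2 a, e v a & e h2 a by apply: noN; rewrite !inE eqxx orbT.
have [b|b] := bipC [set x in [:: c0; c1; c2; c3; c4]].
  by apply: (bipartite_pentagon b _ _ _ _ _ e01 e12 e23 e34 e40); rewrite !inE eqxx ?orbT.
have notC x : x \notin H -> x \in ~: [set x in [:: c0; c1; c2; c3; c4]].
  apply: contraNT; rewrite in_setC inE negbK => xC; apply: sH.
  by move: xC; rewrite !inE => /or4P[|||/orP[]] ->; rewrite ?orbT.
have := u; rewrite -[X in uniq X]/([:: c0; c1; c2; c3; c4] ++ [:: h1; h2]) cat_uniq.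
rewrite has_sym => /and3P[_ /hasPn hC _].
have notC' x : x \in [:: h1; h2] -> x \in ~: [set x in [:: c0; c1; c2; c3; c4]].
  by move=> xh; rewrite in_setC inE; apply/negP => /hC; rewrite /= xh.
apply: (bipartite_pentagon (a:=v) (b:=a1) (c:=h1) (d:=h2) (f:=a2) b) => //.
- by apply: notC; rewrite mem_H eqxx.
- by apply: notC; rewrite mem_H va1 andbF.
- by apply: notC'; rewrite !inE eqxx.
- by apply: notC'; rewrite !inE eqxx orbT.
- by apply: notC; rewrite mem_H va2 andbF.
- by rewrite esym.
- by rewrite esym.
Qed.

(** The vertices [c1], [h1], [h2] are pairwise nonadjacent. Adding [v] and [c3], or [v] and [c4],
    cannot give five independent vertices, so [h2] is adjacent to both [c3] and [c4], which makes a
    triangle. *)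
Lemma no_pentagon_rest c0 c1 c2 c3 c4 h1 h2 :
  uniq [:: c0; c1; c2; c3; c4; h1; h2] ->
  {subset [:: c0; c1; c2; c3; c4; h1; h2] <= H} ->
  e c0 c1 -> e c1 c2 -> e c2 c3 -> e c3 c4 -> e c4 c0 ->
  e h1 c0 -> e h1 c2 -> False.
Proof.
move=> u sH e01 e12 e23 e34 e40 h10 h12.
have h1h2 := pentagon_rest_nonadj u sH e01 e12 e23 e34 e40.
(* [h1] can replace [c1] in the pentagon *)
have sub : perm_eq [:: c0; h1; c2; c3; c4; c1; h2] [:: c0; c1; c2; c3; c4; h1; h2].
  apply/permP => p /=.
  by rewrite !(addnCA (p h1)) -!(addnCA (p c1)).
have c1h2 : ~~ e c1 h2.
  apply: (@pentagon_rest_nonadj c0 h1 c2 c3 c4) => //.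
  - by rewrite (perm_uniq sub).
  - by move=> x; rewrite (perm_mem sub) => /sH.
  - by rewrite esym.
(* The mask [m] extracts the four vertices from the list of seven, whence their distinctness. *)
have i4 c m : mask m [:: c0; c1; c2; c3; c4; h1; h2] = [:: c1; c; h1; h2] ->
    ~~ e h1 c -> ~~ e c1 c -> e h2 c.
  move=> mE h1c c1c; apply/negPn/negP => h2c.
  have allH : all (mem H) [:: c1; c; h1; h2].
    by rewrite -mE; apply/allP => x /mem_mask /sH.
  suff : 5 <= 4 by [].
  apply: (@indep_seq_le4 [:: v; c1; c; h1; h2]).
    rewrite cons_uniq -mE mask_uniq // mE andbT.
    by apply/negP => /(allP allH) /=; rewrite mem_H eqxx.
  have vH x : x \in H -> ~~ e v x by rewrite mem_H => /andP[].
  move: allH; rewrite /= !(esym c) !(esym c1 h1) => /and5P[/vH -> /vH -> /vH -> /vH -> _].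
  by rewrite c1c h1c h2c h1h2 c1h2 !andbT /=; apply/negP => h11; exact: no_triangle h10 e01 h11.
have notri x y z : e x y -> e y z -> ~~ e x z.
  by move=> xy yz; apply/negP => xz; exact: no_triangle xy yz xz.
have h2c3 : e h2 c3.
  apply: (i4 _ [:: false; true; false; true; false; true; true]) => //.
  - exact: notri h12 e23.
  - exact: notri e12 e23.
have h2c4 : e h2 c4.
  apply: (i4 _ [:: false; true; false; false; true; true; true]) => //.
  - by apply: notri h10 _; rewrite esym.
  - by apply: (@notri _ c0); rewrite esym.
exact: no_triangle h2c3 e34 h2c4.
Qed.

(** Of the two vertices of [H] off the pentagon, [h1] has at least two neighbours on it. These are
    not adjacent, so after a rotation [no_pentagon_rest] applies. *)
Lemma no_pentagon c0 c1 c2 c3 c4 :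
  {subset [:: c0; c1; c2; c3; c4] <= H} ->
  e c0 c1 -> e c1 c2 -> e c2 c3 -> e c3 c4 -> e c4 c0 -> False.
Proof.
move=> sH e01 e12 e23 e34 e40.
have ne x y : e x y -> x != y by apply: contraL => /eqP ->; rewrite eirr.
have ne3 x y z t : e x y -> e y z -> e z t -> x != t.
  move=> xy yz zt; apply/eqP => xt; apply: (no_triangle xy yz).
  by rewrite esym xt.
have u : uniq [:: c0; c1; c2; c3; c4].
  rewrite /= !inE !negb_or (ne _ _ e01) (ne _ _ e12) (ne _ _ e23) (ne _ _ e34).
  rewrite (eq_sym c0 c4) (ne _ _ e40) (eq_sym c0 c2) (eq_sym c1 c3) (eq_sym c2 c4).
  by rewrite (ne3 _ _ _ _ e01 e12 e23) (ne3 _ _ _ _ e12 e23 e34) (ne3 _ _ _ _ e23 e34 e40)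
    (ne3 _ _ _ _ e34 e40 e01) (ne3 _ _ _ _ e40 e01 e12).
have /card_gt1P[h1 [h2 []]] : 1 < #|H :\: [set x in [:: c0; c1; c2; c3; c4]]|.
  have := cardsID [set x in [:: c0; c1; c2; c3; c4]] H; rewrite card_H.
  have := subset_leq_card (subsetIr H [set x in [:: c0; c1; c2; c3; c4]]).
  have -> : #|[set x in [:: c0; c1; c2; c3; c4]]| = 5 by rewrite cardsE; apply/card_uniqP.
  by lia.
rewrite !in_setD => /andP[h1C h1H] /andP[h2C h2H] h12.
have u7 : uniq ([:: c0; c1; c2; c3; c4] ++ [:: h1; h2]).
  rewrite cat_uniq u andTb [uniq [:: h1; h2]]/= inE h12 !andbT; apply/hasPn => x.
  by rewrite !inE => /orP[] /eqP ->; [move: h1C | move: h2C]; rewrite !inE.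
have sH7 : {subset [:: c0; c1; c2; c3; c4] ++ [:: h1; h2] <= H}.
  move=> x; rewrite mem_cat => /orP[/sH//|].
  by rewrite !inE => /orP[] /eqP ->; rewrite -?in_setC; [move: h1H | move: h2H]; rewrite !inE.
have adj x y : e x y -> ~~ (e h1 x && e h1 y).
  by move=> xy; apply/negP => /andP[hx hy]; exact: no_triangle hx xy hy.
have rot a b c d f : perm_eq [:: a; b; c; d; f] [:: c0; c1; c2; c3; c4] ->
    e a b -> e b c -> e c d -> e d f -> e f a -> ~~ (e h1 a && e h1 c).
  rewrite -(perm_cat2r [:: h1; h2]) => pE ab bc cd df fa; apply/negP => /andP[h1a h1c].
  apply: (no_pentagon_rest _ _ ab bc cd df fa h1a h1c).
    by move: u7; rewrite -(perm_uniq pE); apply.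
  by move=> x; rewrite -[[:: a, b & _]]/([:: a; b; c; d; f] ++ [:: h1; h2]) (perm_mem pE) => /sH7.
have rE k : perm_eq (seq.rot k [:: c0; c1; c2; c3; c4]) [:: c0; c1; c2; c3; c4].
  by apply/permPl/perm_rot.
have := dH_ge2 h1H; rewrite (dH_enum _ u7) // !big_cons big_nil eirr.
rewrite (negPf (pentagon_rest_nonadj u7 sH7 e01 e12 e23 e34 e40)).
have := adj _ _ e01; have := adj _ _ e12; have := adj _ _ e23; have := adj _ _ e34.
have := adj _ _ e40; have := rot _ _ _ _ _ (rE 0) e01 e12 e23 e34 e40.
have := rot _ _ _ _ _ (rE 1) e12 e23 e34 e40 e01.
have := rot _ _ _ _ _ (rE 2) e23 e34 e40 e01 e12.
have := rot _ _ _ _ _ (rE 3) e34 e40 e01 e12 e23.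
have := rot _ _ _ _ _ (rE 4) e40 e01 e12 e23 e34.
by case: (e h1 c0); case: (e h1 c1); case: (e h1 c2); case: (e h1 c3); case: (e h1 c4).
Qed.

(** If [h] has three neighbours in [H], the other three vertices [K] of [H] span an edge [x y],
    since [h |: K] is not independent. Each of [x] and [y] has a neighbour among those of [h], since
    [H] has no four independent vertices. This closes a walk of length 5 through [h]. *)
Lemma dH2 h : h \in H -> dH h = 2.
Proof.
move=> hH; apply/eqP; rewrite eqn_leq dH_ge2 // andbT leqNgt; apply/negP => d3.
have hN : h \notin N h :&: H by rewrite !inE eirr.
have hNH : h |: (N h :&: H) \subset H.
  by apply/subsetP => x /setU1P[->//|/setIP[]].
set K := H :\: (h |: (N h :&: H)).
have cK : #|K| = 3.
  by rewrite cardsDS // card_H cardsU1 hN; have := dH_le3 h; move: d3; rewrite /dH; lia.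
have KP x : x \in K -> [/\ x \in H, x != h & ~~ e h x].
  move/setDP=> [xH]; rewrite in_setU1 in_setI xH andbT inE negb_or.
  by case/andP.
have [|x [y [xK yK xy]]] := @not_indep K.
  move=> iK; have : #|h |: K| <= 3.
    apply: indep_H; last by apply: indepU1 => // z /KP[].
    by apply/subsetP => z /setU1P[->//|/KP[]].
  by rewrite cardsU1 cK; case: (boolP (h \in K)) => // /KP[]; rewrite eqxx.
have KN z : z \in K -> exists2 p, p \in N h :&: H & e z p.
  move=> zK; have [zH zh hz] := KP z zK.
  case: (boolP [exists p in N h :&: H, e z p]) => [/exists_inP[p]|]; first by exists p.
  rewrite negb_exists_in => /forall_inP noz.
  have : #|z |: (N h :&: H)| <= 3.
    apply: indep_H; last first.
      by apply: indepU1 => //; apply: indepS (@indep_nbrs h); apply: subsetIl.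
    by apply/subsetP => t /setU1P[->//|/setIP[]].
  by rewrite cardsU1 in_setI inE (negPf hz) /=; move: d3; rewrite /dH; lia.
have [p pN xp] := KN x xK; have [q qN yq] := KN y yK.
move: pN qN => /setIP[+ pH] /setIP[+ qH]; rewrite !inE => hp hq.
have [[xH _ _] [yH _ _]] := (KP _ xK, KP _ yK).
apply: (@no_pentagon h p x y q) => //; try by rewrite esym.
by apply/allP; rewrite /= hH pH xH yH qH.
Qed.

(* Each vertex of [H] sees at most one vertex of degree 3, while the four
   vertices of degree 3 considered here send at least 8 edges into [H]. *)
Lemma core_false : False.
Proof.
have d4 a : 3 <= #|N a| <= 4 by rewrite deg_ge3 deg_le4.
have := sum_dH; rewrite (eq_bigr (fun=> 2) dH2) sum_nat_const card_H => sE.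
pose T := [set x in H | #|N x| == 3].
(* Once the degrees in [N v] are known to sum to at most 15, this and [sE] give [3 <= #|T|]. *)
have sT : 28 <= \sum_(h in H) #|N h| + #|T|.
  have -> : #|T| = \sum_(h in H) (#|N h| == 3).
    rewrite -sum1_card big_mkcond [RHS]big_mkcond /=; apply: eq_bigr => x _.
    by rewrite inE; case: (x \in H); case: (_ == 3).
  rewrite -big_split /=.
  apply: (@leq_trans (\sum_(h in H) 4)); first by rewrite sum_nat_const card_H.
  by apply: leq_sum => x _; have := d4 x; case: eqP; lia.
(* With all degrees equal to 4, [sE] would read 14 + 16 = 28 + 4. *)
have [s vs ds] : exists2 s, e v s & #|N s| = 3.
  apply: vS; case: (boolP [exists s, #|N s| == 3]) => [/existsP[s /eqP]|]; first by exists s.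
  rewrite negb_exists => /forallP no3; exfalso.
  have : #|T| = 0 by apply: eq_card0 => x; rewrite !inE (negPf (no3 x)) andbF.
  have : \sum_(a in N v) #|N a| <= \sum_(a in N v) 4.
    by apply: leq_sum => x _; apply: deg_le4.
  by rewrite sum_nat_const dv; lia.
have sv : s \in N v by rewrite inE.
have sN : \sum_(a in N v) #|N a| <= 15.
  rewrite (big_setD1 s sv) /= ds.
  have : \sum_(x in N v :\ s) #|N x| <= \sum_(x in N v :\ s) 4.
    by apply: leq_sum => x _; apply: deg_le4.
  rewrite sum_nat_const; have := cardsD1 s (N v); rewrite sv dv; lia.
have sNT : s \notin T by rewrite !inE vs orbT.
have : \sum_(h in H) #|N h :&: (s |: T)| <= \sum_(h in H) 1.
  apply: leq_sum => h _; apply/card_le1_eqP => x y; rewrite !inE.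
  move=> /andP[hx xS] /andP[hy yS]; apply: deg3_nbr_uniq hy hx _ _.
    by case/orP: yS => [/eqP ->//|/andP[_ /eqP]].
  by case/orP: xS => [/eqP ->//|/andP[_ /eqP]].
rewrite sum_nbrs_setI sum_nat_const card_H big_setU1 //=.
rewrite (eq_bigr (fun=> 2)) => [|x]; last by rewrite inE => /andP[/dH2].
rewrite sum_nat_const.
have := cardsD1 v (N s); rewrite inE esym vs ds.
have -> : N s :\ v = N s :&: H; last by lia.
apply/setP => x; rewrite !inE negb_or andbC; case sx: (e s x) => //=.
case: (x == v) => //=; symmetry; apply/negP => vx; exact: no_triangle vs sx vx.
Qed.
End Core.

Lemma no_extremal_graph : False.
Proof. by have [v [dv vS]] := deg4_near_deg3; exact: core_false dv vS. Qed.
End Extremal.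

Lemma exists_indep5 : #|V| = 12 ->
  (forall A : {set V}, bipartite e A \/ bipartite e (~: A)) ->
  exists2 S : {set V}, indep e S & 5 <= #|S|.
Proof.
move=> V12 bipC; apply: contrapT => no; apply: no_extremal_graph => // S iS.
by rewrite leqNgt; apply/negP => S5; apply: no; exists S.
Qed.
End Graph.
End FiniteGraphs.

(** * Crossing parity of antipodal polygons *)

Local Open Scope ring_scope.

Local Notation x_ u := (u ord0 (0 : 'I_3)).
Local Notation y_ u := (u ord0 (1 : 'I_3)).
Local Notation z_ u := (u ord0 (2%:R : 'I_3)).

Lemma sum3 (R : nmodType) (F : 'I_3 -> R) : \sum_(i < 3) F i = F 0 + F 1 + F 2%:R.
Proof.
rewrite !big_ord_recl big_ord0 addr0 addrA.
by congr (_ + F _ + F _); apply: val_inj.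
Qed.

Definition dot (R : comNzRingType) (u v : 'rV[R]_3) : R :=
  x_ u * x_ v + y_ u * y_ v + z_ u * z_ v.

Definition det3 (R : comNzRingType) (u v w : 'rV[R]_3) : R :=
  x_ u * (y_ v * z_ w - z_ v * y_ w) + y_ u * (z_ v * x_ w - x_ v * z_ w)
  + z_ u * (x_ v * y_ w - y_ v * x_ w).

Definition sqcross (R : comNzRingType) (u v : 'rV[R]_3) : R :=
  dot u u * dot v v - dot u v ^+ 2.

Section Parity.
Variable R : realFieldType.
Implicit Types u v w : 'rV[R]_3.

Definition sdet u v w := det3 u v w < 0.

(* For vectors in general position, this says that the images of the arcs [v, v']
   and [w, w'] in the projective plane cross. *)
Definition crosses v v' w w' :=
  (sdet v v' w (+) sdet v v' w') && (sdet w w' v (+) sdet w w' v').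

(** Three nonzero reals with sum 0 do not all have the same sign; each xor is the sign of a
    product. *)
Lemma sum3_sign (a b c p q r : R) :
  a != 0 -> b != 0 -> c != 0 -> p != 0 -> q != 0 -> r != 0 ->
  a * p + b * q + c * r = 0 ->
  ~~ (((a < 0) (+) (p < 0) == (b < 0) (+) (q < 0)) &&
      ((b < 0) (+) (q < 0) == (c < 0) (+) (r < 0))).
Proof.
have sgM (x y : R) : x != 0 -> y != 0 -> (x < 0) (+) (y < 0) = (x * y < 0).
  move=> x0 y0; have [xn|xp|xe] := ltgtP x 0; last by rewrite xe eqxx in x0.
    by rewrite nmulr_rlt0 // lt0r y0 /= leNgt; case: (y < 0).
  by rewrite pmulr_rlt0.
move=> a0 b0 c0 p0 q0 r0; rewrite !sgM // => s0; apply/negP => /andP[].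
have [ap|ap] := ltrP (a * p) 0; have [bq|bq] := ltrP (b * q) 0;
  have [cr|cr] := ltrP (c * r) 0 => // _ _.
  by lra.
have := mulf_neq0 a0 p0; rewrite (_ : a * p = 0) ?eqxx //; lra.
Qed.

(** For independent [w1], [w2], [w3], [T u] says that [u] or [- u] lies in the open cone they span:
    an arc crosses the boundary of a projective triangle an odd number of times iff it has exactly
    one end inside. The Plücker relations exclude the sign patterns for which the identity fails. *)
Lemma crosses_triangle v v' w1 w2 w3 :
  [&& det3 v v' w1 != 0, det3 v v' w2 != 0 & det3 v v' w3 != 0] ->
  [&& det3 w1 w2 v != 0, det3 w2 w3 v != 0 & det3 w3 w1 v != 0] ->
  [&& det3 w1 w2 v' != 0, det3 w2 w3 v' != 0 & det3 w3 w1 v' != 0] ->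
  let T u := (sdet w1 w2 u == sdet w2 w3 u) && (sdet w2 w3 u == sdet w3 w1 u) in
  crosses v v' w1 w2 (+) crosses v v' w2 w3 (+) crosses v v' w3 w1 = T v (+) T v'.
Proof.
move=> /and3P[a1 a2 a3] /and3P[p1 p2 p3] /and3P[q1 q2 q3] /=.
have := @sum3_sign _ _ _ _ _ _ a1 a2 a3 p2 p3 p1.
have := @sum3_sign _ _ _ _ _ _ a1 a2 a3 q2 q3 q1.
rewrite /crosses /sdet.
have -> : det3 v v' w1 * det3 w2 w3 v' + det3 v v' w2 * det3 w3 w1 v' +
  det3 v v' w3 * det3 w1 w2 v' = 0 by rewrite /det3; ring.
have -> : det3 v v' w1 * det3 w2 w3 v + det3 v v' w2 * det3 w3 w1 v +
  det3 v v' w3 * det3 w1 w2 v = 0 by rewrite /det3; ring.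
move=> /(_ erefl) + /(_ erefl).
case: (_ < 0); case: (_ < 0); case: (_ < 0); case: (_ < 0); case: (_ < 0);
case: (_ < 0); case: (_ < 0); case: (_ < 0); by case: (_ < 0).
Qed.

Lemma det3C12 u v w : det3 v u w = - det3 u v w.
Proof. by rewrite /det3; ring. Qed.

Lemma det3N u v w : det3 u v (- w) = - det3 u v w.
Proof. by rewrite /det3 !mxE; ring. Qed.

Lemma sdetN u v w w' : det3 u v w != 0 -> det3 u v w' = - det3 u v w -> sdet u v w' = ~~ sdet u v w.
Proof. by move=> n0 E; rewrite /sdet E oppr_lt0 -leNgt le_eqVlt eq_sym (negPf n0). Qed.

Lemma crossesC v v' w w' : det3 w w' v != 0 -> det3 w w' v' != 0 ->
  crosses v v' w' w = crosses v v' w w'.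
Proof.
move=> h h'; rewrite /crosses /sdet (det3C12 w w' v) (det3C12 w w' v') !oppr_lt0.
rewrite ![_ < det3 _ _ _]lt_neqAle ![0 == _]eq_sym h h' /= !leNgt addbC.
by case: (_ < 0); case: (_ < 0); case: (_ < 0); case: (_ < 0).
Qed.

(** The arcs from [w] to [w'] and from [w'] to [- w] form half a great circle, whose projective
    image is the whole line of the plane of [w] and [w']. *)
Lemma crosses_half v v' w w' : det3 v v' w != 0 -> 
  crosses v v' w w' (+) crosses v v' w' (- w) = sdet w w' v (+) sdet w w' v'.
Proof.
move=> h; rewrite /crosses.
have E u : sdet w' (- w) u = sdet w w' u.
  by rewrite /sdet; congr (_ < _); rewrite /det3 !mxE; ring.
rewrite (sdetN h (det3N v v' w)) !E.
by case: (sdet _ _ _); case: (sdet _ _ _); case: (sdet _ _ _); case: (sdet _ _ _).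
Qed.

Lemma addb_telescope (f : nat -> bool) m :
  \big[addb/false]_(i < m) (f i (+) f i.+1) = f 0%N (+) f m.
Proof.
elim: m => [|m IH]; first by rewrite big_ord0 addbb.
by rewrite big_ord_recr /= IH addbA addbK.
Qed.

(* The polygon W is the sum modulo 2 of the triangles W0 Wj Wj+1 and of half a
   great circle from W0 to -W0; the closed curve V crosses the former an even
   number of times and the latter an odd number of times. *)
Lemma antipodal_polygons_cross (V W : nat -> 'rV[R]_3) m n :
  (1 < m)%N -> (1 < n)%N -> V m = - V 0%N -> W n = - W 0%N ->
  (forall i i' j, (i < m)%N -> (i' < m)%N -> (j < n)%N -> i != i' ->
     det3 (V i) (V i') (W j) != 0) ->
  (forall i j j', (i < m)%N -> (j < n)%N -> (j' < n)%N -> j != j' ->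
     det3 (W j) (W j') (V i) != 0) ->
  exists i j, [/\ (i < m)%N, (j < n)%N & crosses (V i) (V i.+1) (W j) (W j.+1)].
Proof.
move=> m1 n1 Vm Wn gV gW.
have {}gW i j j' : (i <= m)%N -> (j < n)%N -> (j' < n)%N -> j != j' ->
     det3 (W j) (W j') (V i) != 0.
  rewrite leq_eqVlt => /orP[/eqP ->|]; last exact: gW.
  by rewrite Vm det3N oppr_eq0; apply: gW; lia.
have {}gV i j : (i < m)%N -> (j < n)%N -> det3 (V i) (V i.+1) (W j) != 0.
  move=> im jn; have [mE|ni] := eqVneq i.+1 m; last by apply: gV => //; lia.
  rewrite mE Vm.
  have -> : det3 (V i) (- V 0%N) (W j) = - det3 (V i) (V 0%N) (W j).
    by rewrite /det3 !mxE; ring.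
  by rewrite oppr_eq0; apply: gV => //; lia.
have sNV0 j k : (j < n)%N -> (k < n)%N -> j != k ->
    sdet (W j) (W k) (V m) = ~~ sdet (W j) (W k) (V 0%N).
  by move=> jn kn jk; apply: sdetN; [apply: gW | rewrite Vm det3N].
pose C w w' := \big[addb/false]_(i < m) crosses (V i) (V i.+1) w w'.
have CC j k : (j < n)%N -> (k < n)%N -> j != k -> C (W k) (W j) = C (W j) (W k).
  move=> jn kn jk; apply: eq_bigr => i _; apply: crossesC; apply: gW => //.
  by apply: ltnW.
(* The indicator [T] of a triangle agrees at [V 0] and [V m = - V 0], so the sum telescopes to
   [false]. *)
have C3 j : (0 < j)%N -> (j.+1 < n)%N ->
    C (W 0%N) (W j.+1) = C (W 0%N) (W j) (+) C (W j) (W j.+1).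
  move=> j0 jn; have jn' := ltnW jn; have n0 := ltnW n1.
  have j0' : 0%N != j by rewrite eq_sym -lt0n.
  have jj : j != j.+1 by rewrite neq_ltn leqnn.
  have : C (W 0%N) (W j) (+) C (W j) (W j.+1) (+) C (W j.+1) (W 0%N) = false.
    rewrite /C -!big_split /=.
    pose T u := (sdet (W 0%N) (W j) u == sdet (W j) (W j.+1) u) &&
                (sdet (W j) (W j.+1) u == sdet (W j.+1) (W 0%N) u).
    rewrite (eq_bigr (fun i : 'I_m => T (V i) (+) T (V i.+1))) => [|i _].
      rewrite (addb_telescope (T \o V)) /= /T !sNV0 //.
      by case: (sdet _ _ _); case: (sdet _ _ _); case: (sdet _ _ _).
    by apply: crosses_triangle; rewrite ?gV ?gW // ltnW.
  by rewrite (CC 0%N j.+1) //; case: (C _ _); case: (C _ _); case: (C _ _).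
have Cn k : (0 < k)%N -> (k < n)%N ->
    C (W 0%N) (W k) = \big[addb/false]_(j < k) C (W j) (W j.+1).
  elim: k => // -[_ _ _|k IH _ kn]; first by rewrite big_ord_recr big_ord0.
  by rewrite big_ord_recr /= C3 // IH // ltnW.
(* The fan of triangles reduces all sides but the last to the arc from [W 0] to [W n.-1]. With the
   last side it forms half a great circle, and [V 0] and [- V 0] lie on different sides of its
   plane. *)
have tot : \big[addb/false]_(j < n) C (W j) (W j.+1) = true.
  have nE : n = n.-1.+1 by rewrite prednK // ltnW.
  rewrite nE big_ord_recr /= -Cn -?nE ?Wn; try lia.
  rewrite /C -big_split /=.
  pose f i := sdet (W 0%N) (W n.-1) (V i).
  rewrite (eq_bigr (fun i : 'I_m => f i (+) f i.+1)) => [|i _]; last first.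
    by apply: crosses_half; apply: gV => //; lia.
  by rewrite addb_telescope /f sNV0; [case: (sdet _ _ _) | lia..].
have /existsP[j /existsP[i cr]] : [exists j : 'I_n, exists i : 'I_m,
   crosses (V i) (V i.+1) (W j) (W j.+1)].
  rewrite -[X in is_true X]negbK negb_exists; apply/negP => /forallP no.
  move: tot; rewrite big1 // => j _; apply: big1 => i _; apply/negP => cr.
  by have := no j; rewrite negb_exists => /forallP /(_ i); rewrite cr.
by exists i, j.
Qed.
End Parity.

(** * Passing to the limit of generic perturbations *)

Definition segpt (R : comNzRingType) (u v : 'rV[R]_3) (s : R) := (1 - s) *: u + s *: v.

Lemma sqcrossZ (R : comNzRingType) k l (u v : 'rV[R]_3) :
  sqcross (k *: u) (l *: v) = (k * l) ^+ 2 * sqcross u v.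
Proof. by rewrite /sqcross /dot !mxE; ring. Qed.

(** The vectors [d *: v - c *: v'] and [a *: w' - b *: w] are equal and lie in both planes. As [c],
    [d] have opposite signs, and so do [a], [b], rescaling turns them, up to sign, into points of
    the two segments. *)
Lemma crosses_segpt (R : realFieldType) (v v' w w' : 'rV[R]_3) :
  crosses v v' w w' ->
  exists s t, [/\ 0 <= s <= 1, 0 <= t <= 1 & sqcross (segpt v v' s) (segpt w w' t) = 0].
Proof.
rewrite /crosses /sdet => /andP[].
pose a := det3 v v' w; pose b := det3 v v' w'; pose c := det3 w w' v; pose d := det3 w w' v'.
rewrite -/a -/b -/c -/d => ab cd.
have norms (p q : R) : (p < 0) (+) (q < 0) ->
    exists e : R, [/\ `|p| = - e * p, `|q| = e * q, e ^+ 2 = 1 & 0 < `|p| + `|q|].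
  case: ltrP => p0; case: ltrP => q0 // _.
    by exists 1; rewrite (ltr0_norm p0) (ger0_norm q0); split; lra.
  by exists (-1); rewrite (ger0_norm p0) (ltr0_norm q0); split; lra.
have [e [aE bE ee ab0]] := norms _ _ ab; have [f [cE dE ff cd0]] := norms _ _ cd.
have frac (p q : R) : 0 < `|p| + `|q| ->
    0 <= `|p| / (`|p| + `|q|) <= 1 /\ 1 - `|p| / (`|p| + `|q|) = `|q| / (`|p| + `|q|).
  move=> pq; split; last by field; rewrite gt_eqF.
  by rewrite divr_ge0 ?ler_pdivrMr ?mul1r ?lerDl //= ltW.
have [s01 sE] := frac _ _ cd0; have [t01 tE] := frac _ _ ab0.
exists (`|c| / (`|c| + `|d|)), (`|a| / (`|a| + `|b|)); split => //.
have segE (u u' : 'rV[R]_3) (p q : R) : 0 < `|p| + `|q| ->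
   segpt u u' (`|p| / (`|p| + `|q|)) = (`|p| + `|q|)^-1 *: (`|q| *: u + `|p| *: u').
  by move=> pq; rewrite /segpt (frac p q pq).2 scalerDr !scalerA ![_^-1 * _]mulrC.
rewrite !segE // sqcrossZ (_ : sqcross _ _ = 0) ?mulr0 //.
have -> : `|d| *: v + `|c| *: v' = (f * - e) *: (`|b| *: w + `|a| *: w').
  rewrite aE bE cE dE; apply/rowP => i.
  have H : (d *: v - c *: v') 0 i = (a *: w' - b *: w) 0 i.
    have : i = 0 \/ i = 1 \/ i = 2%:R.
      by case: i => [[|[|[|]]]] // h; [left | right; left | right; right]; apply: val_inj.
    by case=> [|[]] ->; rewrite !mxE /a /b /c /d /det3; ring.
  rewrite !mxE in H *.
  transitivity (f * (d * v 0 i - c * v' 0 i)); first by ring.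
  by rewrite H; transitivity (e ^+ 2 * (f * (a * w' 0 i - b * w 0 i))); [rewrite ee; ring | ring].
by rewrite /sqcross /dot !mxE; ring.
Qed.

Lemma nonroot_near0 (R : realFieldType) (p : {poly R}) (eta : R) :
  p != 0 -> 0 < eta -> exists eps, [/\ 0 < eps, eps < eta & p.[eps] != 0].
Proof.
(* These are [size p] distinct candidates, too many to be all roots; the shift by 2 keeps them
   strictly below [eta]. *)
move=> p0 e0; pose r k : R := eta / k.+2%:R.
case: (boolP (all (fun k => root p (r k)) (iota 0 (size p)))) => [/allP al|].
  have ar : all (root p) [seq r k | k <- iota 0 (size p)].
    by apply/allP => x /mapP[k /al rk ->].
  have ur : uniq [seq r k | k <- iota 0 (size p)].
    rewrite map_inj_uniq ?iota_uniq // => k l /(mulfI (lt0r_neq0 e0)) /invr_inj /eqP.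
    by rewrite eqr_nat => /eqP [].
  by have := max_poly_roots p0 ar ur; rewrite size_map size_iota ltnn.
rewrite -has_predC => /hasP[k _ /= rk]; exists (r k); split=> //.
- by rewrite divr_gt0.
- by rewrite ltr_pdivrMr // ltr_pMr // ltr1n.
Qed.

Definition moment (R : nzRingType) (k : nat) : 'rV[R]_3 := \row_i k%:R ^+ i.

Lemma det3_moment (R : numDomainType) k l m : k != l -> k != m -> l != m ->
  det3 (moment R k) (moment R l) (moment R m) != 0.
Proof.
move=> kl km lm.
have -> : det3 (moment R k) (moment R l) (moment R m) =
  (l%:R - k%:R) * (m%:R - k%:R) * (m%:R - l%:R) by rewrite /det3 /moment !mxE /=; ring.
by rewrite !mulf_neq0 // subr_eq0 eqr_nat eq_sym.
Qed.

(** The coefficient of the cube of [e] is [det3 g h k]. *)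
Lemma perturbed_det (R : numDomainType) (u v w g h k : 'rV[R]_3) :
  det3 g h k != 0 ->
  exists2 p : {poly R}, p != 0 &
    forall e, p.[e] = det3 (u + e *: g) (v + e *: h) (w + e *: k).
Proof.
move=> ghk.
pose b := det3 g v w + det3 u h w + det3 u v k.
pose c := det3 g h w + det3 g v k + det3 u h k.
exists (Poly [:: det3 u v w; b; c; det3 g h k]).
  apply: contra ghk => /eqP /(congr1 (fun p : {poly R} => p`_3)).
  by rewrite coef_Poly coef0 /= => ->.
by move=> e; rewrite horner_Poly /= /b /c /det3 !mxE; ring.
Qed.

Lemma generic_eps (R : realFieldType) (A : finType) (D : A -> R -> R) eta :
  (forall x, exists2 p : {poly R}, p != 0 & forall e, p.[e] = D x e) -> 0 < eta ->
  exists e, 0 < e < eta /\ forall x, D x e != 0.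
Proof.
move=> /(_ _)/cid2 P eta0; pose p := \prod_x projT1 (P x).
have [|e [e0 el pe]] := @nonroot_near0 _ p eta _ eta0.
  by apply/prodf_neq0 => x _; case: (P x).
exists e; rewrite e0 el; split=> // x; move: pe; rewrite /p horner_prod.
by move/prodf_neq0 => /(_ x isT); case: (P x) => /= q _ ->.
Qed.

Section Limit.
Variable R : realType.

(** The zeros of [F] in the unit cube form a compact set; the least first coordinate on it cannot be
    positive, since there are zeros with a smaller positive one. *)
Lemma zero_limit (F : R * R * R -> R) : continuous F ->
  (forall eta : R, 0 < eta -> exists eps s t : R,
    [/\ 0 < eps < eta, 0 <= s <= 1, 0 <= t <= 1 & F (eps, s, t) = 0]) ->
  exists s t : R, [/\ 0 <= s <= 1, 0 <= t <= 1 & F (0, s, t) = 0].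
Proof.
move=> cF zF.
pose I := `[0 : R, 1]%classic.
pose Z := ((I `*` I `*` I) `&` (F @^-1` [set x | x = 0]))%classic.
have cZ : compact Z.
  apply: compact_closedI.
    by apply: compact_setX; [apply: compact_setX|]; exact: segment_compact.
  by apply: preimage_closed => [x _|]; [exact: cF|exact: closed_eq].
have inZ e s t : Z (e, s, t) <-> [/\ 0 <= e <= 1, 0 <= s <= 1, 0 <= t <= 1 & F (e, s, t) = 0].
  rewrite /Z /I /=; rewrite !in_itv /=; split; first by case=> [[[]]].
  by case.
have [e [s [t [/andP[e0 e1] s01 t01 Fe]]]] := zF 1 ltr01.
have Z0 : (Z !=set0)%classic by exists (e, s, t); apply/inZ; split; rewrite // !ltW.
have [|[[e' s'] t']] := @compact_EVT_min _ _ (fun x : R * R * R => x.1.1) _ Z0 cZ.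
  apply: continuous_subspaceT => x.
  by apply: continuous_comp; apply: cvg_fst.
rewrite inE => /inZ[/andP[e'0 e'1] s'01 t'01 Fe'] emin.
suff e'E : e' = 0 by exists s', t'; rewrite e'E in Fe'.
apply/eqP; rewrite eq_le e'0 leNgt andbT; apply/negP.
move=> /zF[e2 [s2 [t2 [/andP[e20 e2l] s201 t201 F2]]]].
have : (e2, s2, t2) \in Z by rewrite inE; apply/inZ; split => //; lra.
by move=> /emin /=; rewrite leNgt e2l.
Qed.

End Limit.

Section Meet.
Variable R : realType.

(* Points of the moment curve with distinct parameters put all the vertices in
   general position for all but finitely many [e], and antipodality is kept. *)
Definition perturb (V : nat -> 'rV[R]_3) (m k : nat) (e : R) (i : nat) : 'rV[R]_3 :=
  if (i < m)%N then V i + e *: moment R (k + i) else - (V 0%N + e *: moment R k).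

Lemma continuous_dot (T : topologicalType) (u v : T -> 'rV[R]_3) :
  (forall i, continuous (fun x => u x 0 i)) -> (forall i, continuous (fun x => v x 0 i)) ->
  continuous (fun x => dot (u x) (v x)).
Proof.
by move=> cu cv x; apply: cvgD; [apply: cvgD|]; apply: cvgM; (apply: cu || apply: cv).
Qed.

Lemma continuous_sqcross (T : topologicalType) (u v : T -> 'rV[R]_3) :
  (forall i, continuous (fun x => u x 0 i)) -> (forall i, continuous (fun x => v x 0 i)) ->
  continuous (fun x => sqcross (u x) (v x)).
Proof.
move=> cu cv x; apply: cvgB; apply: cvgM; exact: continuous_dot.
Qed.

Lemma continuous_segpt (T : topologicalType) (u v : T -> 'rV[R]_3) (s : T -> R) i :
  continuous (fun x => u x 0 i) -> continuous (fun x => v x 0 i) -> continuous s ->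
  continuous (fun x => segpt (u x) (v x) (s x) 0 i).
Proof.
move=> cu cv cs x; under eq_fun do rewrite /segpt !mxE.
apply: cvgD; apply: cvgM; [|exact: cu|exact: cs|exact: cv].
by apply: cvgB; [exact: cvg_cst|exact: cs].
Qed.

Lemma continuous_perturb (T : topologicalType) V m k j (e : T -> R) i :
  continuous e -> continuous (fun x => perturb V m k (e x) j 0 i).
Proof.
move=> ce x; rewrite /perturb; case: (j < m)%N; under eq_fun do rewrite !mxE.
  by apply: cvgD; [exact: cvg_cst | apply: cvgM; [exact: ce | exact: cvg_cst]].
by apply: cvgN; apply: cvgD; [exact: cvg_cst | apply: cvgM; [exact: ce | exact: cvg_cst]].
Qed.

Lemma antipodal_polygons_meet (V W : nat -> 'rV[R]_3) m n :
  (1 < m)%N -> (1 < n)%N -> V m = - V 0%N -> W n = - W 0%N ->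
  exists i j s t, [/\ (i < m)%N, (j < n)%N, 0 <= s <= 1, 0 <= t <= 1 &
    sqcross (segpt (V i) (V i.+1) s) (segpt (W j) (W j.+1) t) = 0].
Proof.
move=> m1 n1 Vm Wn.
(* The moment parameters of [W] start at [m], after those of [V], so that all are distinct. *)
pose S i j (x : R * R * R) := sqcross
  (segpt (perturb V m 0 x.1.1 i) (perturb V m 0 x.1.1 i.+1) x.1.2)
  (segpt (perturb W n m x.1.1 j) (perturb W n m x.1.1 j.+1) x.2).
(* The pair of sides that meet may vary with the perturbation; the product over all pairs vanishes
   in each case. *)
pose F x := \prod_(ij : 'I_m * 'I_n) S ij.1 ij.2 x.
have ce : continuous (fun x : R * R * R => x.1.1).
  by move=> x; apply: continuous_comp; apply: cvg_fst.
have cF : continuous F.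
  apply: (@continuous_big R _ *%R 1) => [|[i j] _]; first exact: mul_continuous.
  apply: continuous_sqcross => k; apply: continuous_segpt; try exact: continuous_perturb.
    by move=> x; apply: continuous_comp; [apply: cvg_fst | apply: cvg_snd].
  by move=> x; apply: cvg_snd.
have pertE (U : nat -> 'rV[R]_3) p k i e : (i < p)%N ->
    perturb U p k e i = U i + e *: moment R (k + i).
  by rewrite /perturb => ->.
have [|s [t [s01 t01 /eqP]]] := zero_limit cF.
  move=> eta eta0.
  (* The value 1 at equal indices keeps the family free of identically zero functions. *)
  pose D (x : 'I_m * 'I_m * 'I_n + 'I_m * 'I_n * 'I_n) e : R := match x with
    | inl (i, i', j) => if i == i' then 1 else
        det3 (perturb V m 0 e i) (perturb V m 0 e i') (perturb W n m e j)
    | inr (i, j, j') => if j == j' then 1 else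
        det3 (perturb W n m e j) (perturb W n m e j') (perturb V m 0 e i) end.
  have [|e [/andP[e0 el] De]] := generic_eps (D := D) _ eta0.
    case=> [[[i i'] j]|[[i j] j']] /=; case: eqVneq => [_|ne].
    - by exists 1; [exact: oner_neq0 | move=> e; rewrite hornerC].
    - have gne : det3 (moment R (0 + i)) (moment R (0 + i')) (moment R (m + j)) != 0.
        by apply: det3_moment => //; have := ltn_ord i; have := ltn_ord i'; lia.
      have [p p0 pE] := perturbed_det (V i) (V i') (W j) gne.
      by exists p => // e; rewrite pE !pertE.
    - by exists 1; [exact: oner_neq0 | move=> e; rewrite hornerC].
    - have gne : det3 (moment R (m + j)) (moment R (m + j')) (moment R (0 + i)) != 0.
        by apply: det3_moment; have := ltn_ord i; rewrite ?eqn_add2l //; lia.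
      have [p p0 pE] := perturbed_det (W j) (W j') (V i) gne.
      by exists p => // e; rewrite pE !pertE.
  have pertN (U : nat -> 'rV[R]_3) p k : (1 < p)%N -> perturb U p k e p = - perturb U p k e 0.
    by move=> p1; rewrite /perturb ltnn addn0 (ltnW p1).
  have gV i i' j : (i < m)%N -> (i' < m)%N -> (j < n)%N -> i != i' ->
      det3 (perturb V m 0 e i) (perturb V m 0 e i') (perturb W n m e j) != 0.
    move=> im i'm jn ii'.
    by have := De (inl (Ordinal im, Ordinal i'm, Ordinal jn)); rewrite /D -val_eqE /= (negPf ii').
  have gW i j j' : (i < m)%N -> (j < n)%N -> (j' < n)%N -> j != j' ->
      det3 (perturb W n m e j) (perturb W n m e j') (perturb V m 0 e i) != 0.
    move=> im jn j'n jj'.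
    by have := De (inr (Ordinal im, Ordinal jn, Ordinal j'n)); rewrite /D -val_eqE /= (negPf jj').
  have [i [j [im jn]]] :=
    antipodal_polygons_cross m1 n1 (pertN V m 0%N m1) (pertN W n m n1) gV gW.
  case/crosses_segpt => s [t [s01 t01 st0]]; exists e, s, t; split; rewrite ?e0 //.
  by apply/eqP; rewrite prodf_seq_eq0; apply/hasP; exists (Ordinal im, Ordinal jn);
    rewrite ?mem_index_enum //= /S st0.
rewrite prodf_seq_eq0 => /hasP[[i j] _ /= /eqP Sij].
exists i, j, s, t; split => //; rewrite -Sij /S /=.
have pV0 (U : nat -> 'rV[R]_3) p k l : U p = - U 0%N -> (l <= p)%N -> perturb U p k 0 l = U l.
  move=> Up; rewrite leq_eqVlt /perturb => /orP[/eqP ->|->]; last by rewrite scale0r addr0.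
  by rewrite ltnn scale0r addr0.
by rewrite !pV0 // ltnW.
Qed.
End Meet.

(** * Arcs of a diameter graph *)

Section Dot.
Variable R : comNzRingType.
Implicit Types u v w : 'rV[R]_3.

Lemma dotC u v : dot u v = dot v u.
Proof. by rewrite /dot; ring. Qed.

Lemma dotDl u v w : dot (u + v) w = dot u w + dot v w.
Proof. by rewrite /dot !mxE; ring. Qed.

Lemma dotZl k u w : dot (k *: u) w = k * dot u w.
Proof. by rewrite /dot !mxE; ring. Qed.

Lemma dotNl u w : dot (- u) w = - dot u w.
Proof. by rewrite /dot !mxE; ring. Qed.

Lemma dotDr u v w : dot w (u + v) = dot w u + dot w v.
Proof. by rewrite /dot !mxE; ring. Qed.

Lemma dotZr k u w : dot w (k *: u) = k * dot w u.
Proof. by rewrite /dot !mxE; ring. Qed.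

Lemma dotNr u w : dot w (- u) = - dot w u.
Proof. by rewrite /dot !mxE; ring. Qed.

Definition dotE := (dotDl, dotDr, dotNl, dotNr, dotZl, dotZr).
End Dot.

Section Arcs.
Variable R : rcfType.
Implicit Types u v w p q r D x y : 'rV[R]_3.

Definition sqdist u v := dot (u - v) (u - v).

Lemma dot_ge0 u : 0 <= dot u u.
Proof. by rewrite /dot; nra. Qed.

Lemma dot_eq0 u : (dot u u == 0) = (u == 0).
Proof.
apply/idP/eqP => [/eqP u0|->]; last by rewrite /dot !mxE !mulr0 !addr0.
have x0 : x_ u = 0 by move: u0; rewrite /dot; nra.
have y0 : y_ u = 0 by move: u0; rewrite /dot; nra.
have z0 : z_ u = 0 by move: u0; rewrite /dot; nra.
apply/rowP => i; rewrite mxE.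
case: i => [[|[|[|]]]] // h; [rewrite -x0|rewrite -y0|rewrite -z0];
  by congr (u _ _); apply: val_inj.
Qed.

(** The equality case of the Cauchy-Schwarz inequality. *)
Lemma sqcross_eq0 u v : u != 0 -> sqcross u v = 0 -> v = (dot u v / dot u u) *: u.
Proof.
move=> u0 c0; apply/eqP; rewrite -subr_eq0 -dot_eq0.
have d0 : dot u u != 0 by rewrite dot_eq0.
have -> : dot (v - (dot u v / dot u u) *: u) (v - (dot u v / dot u u) *: u) =
  sqcross u v / dot u u.
  by rewrite !dotE (dotC v u) /sqcross; field.
by rewrite c0 mul0r.
Qed.

Lemma segpt_dot u v s D : dot (segpt u v s) D = (1 - s) * dot u D + s * dot v D.
Proof. by rewrite !dotE. Qed.

Lemma segpt_norm u v s : dot (segpt u v s) (segpt u v s) =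
  (1 - s) * dot u u + s * dot v v - s * (1 - s) * dot (u - v) (u - v).
Proof. by rewrite !dotE (dotC v u); ring. Qed.

(** Strict convexity of the unit ball. *)
Lemma unit_segpt u v s : dot u u = 1 -> dot v v = 1 ->
  dot (segpt u v s) (segpt u v s) = 1 -> segpt u v s = u \/ segpt u v s = v.
Proof.
move=> u1 v1; rewrite segpt_norm u1 v1 => /eqP h.
have {h}/eqP : s * (1 - s) * dot (u - v) (u - v) = 0 by move/eqP: h; lra.
rewrite !mulf_eq0 dot_eq0 !subr_eq0 -orbA => /or3P[/eqP ->|/eqP <-|/eqP ->].
- by left; rewrite /segpt subr0 scale1r scale0r addr0.
- by right; rewrite /segpt subrr scale0r add0r scale1r.
- by left; rewrite /segpt -scalerDl subrK scale1r.
Qed.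

Lemma segpt_norm_bounds u v s : dot u u = 1 -> dot v v = 1 -> 1 <= 2 * dot u v ->
  0 <= s <= 1 -> 3 / 4 <= dot (segpt u v s) (segpt u v s) <= 1.
Proof.
move=> u1 v1 uv /andP[s0 s1].
have -> : dot (segpt u v s) (segpt u v s) = 1 - 2 * (s * (1 - s)) * (1 - dot u v).
  by rewrite !dotE u1 v1 (dotC v u); ring.
have uv1 : dot u v <= 1.
  have := dot_ge0 (u - v); rewrite !dotE u1 v1 (dotC v u); lra.
have : 0 <= s * (1 - s) by nra.
have : s * (1 - s) <= 1 / 4 by have := sqr_ge0 (s - 1 / 2); rewrite expr2; lra.
move: (s * (1 - s)) => k k4 k0.
have m1 : 0 <= k * (1 - dot u v) by rewrite mulr_ge0 // subr_ge0.
have m2 : 0 <= k * (2 * dot u v - 1) by rewrite mulr_ge0 // subr_ge0.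
by apply/andP; split; lra.
Qed.

(* With [a <= 1] and [b <= 1] the norms of the two points of the arcs on the
   common ray and [c] the component of [D] along it, the bounds on the distances
   give [0 >= a b - (a + b) c + (c ^ 2 + 1) / 2 >= (1 - a) (1 - b) >= 0]. *)
Lemma opposite_arcs p p' r r' D s t k :
  dot p p = 1 -> dot p' p' = 1 -> 1 <= 2 * dot p p' ->
  dot r r = 1 -> dot r' r' = 1 -> 1 <= 2 * dot r r' ->
  dot D D <= 1 ->
  sqdist (p + r) D <= 1 -> sqdist (p + r') D <= 1 ->
  sqdist (p' + r) D <= 1 -> sqdist (p' + r') D <= 1 ->
  D != p -> D != p' -> D != r -> D != r' ->
  0 <= s <= 1 -> 0 <= t <= 1 -> 0 < k -> segpt r r' t = k *: segpt p p' s -> False.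
Proof.
move=> p1 p'1 pp r1 r'1 rr D1 h1 h2 h3 h4 np np' nr nr' s01 t01 k0 zE.
have /andP[z34 z1] := segpt_norm_bounds p1 p'1 pp s01.
have /andP[w34 w1] := segpt_norm_bounds r1 r'1 rr t01.
set z := segpt p p' s in zE z34 z1; set w := segpt r r' t in zE w34 w1.
pose a := Num.sqrt (dot z z).
have aa : a ^+ 2 = dot z z by rewrite sqr_sqrtr // dot_ge0.
have a0 : 0 < a by rewrite sqrtr_gt0; lra.
pose e := a^-1 *: z; pose b := k * a.
have b0 : 0 < b by rewrite mulr_gt0.
have ze : z = a *: e by rewrite scalerA divff ?gt_eqF // scale1r.
have we : w = b *: e by rewrite zE ze scalerA.
have e1 : dot e e = 1.
  by rewrite /e dotZl dotZr -aa; field; rewrite gt_eqF.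
have bb : b ^+ 2 = dot w w by rewrite we dotZl dotZr e1; ring.
clearbody e.
have a1 : a <= 1 by nra.
have b1 : b <= 1 by nra.
(* Both squared norms are at least 3/4, so [a] and [b] exceed 1/2. *)
have ab : 1 < a + b by nra.
pose c := dot e D.
have cD : c ^+ 2 <= dot D D.
  have := dot_ge0 (D - c *: e); rewrite !dotE (dotC D e) e1 -/c; nra.
have c1 : c <= 1 by nra.
(* Each distance bound limits one of the four products of [p - D], [p' - D] with [r - D], [r' - D];
   bilinearity carries the common bound over to [z - D] and [w - D]. *)
have key : a * b - (a + b) * c + (c ^+ 2 + 1) / 2 <= 0.
  have E : dot (z - D) (w - D) <= (dot D D - 1) / 2.
    have dd u v : dot u u = 1 -> dot v v = 1 -> sqdist (u + v) D <= 1 ->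
        dot (u - D) (v - D) <= (dot D D - 1) / 2.
      by rewrite /sqdist !dotE => -> ->; rewrite (dotC v u) (dotC D u) (dotC D v); lra.
    have := dd _ _ p1 r1 h1; have := dd _ _ p1 r'1 h2; have := dd _ _ p'1 r1 h3.
    have := dd _ _ p'1 r'1 h4; move: (_ / 2) => M.
    have -> : dot (z - D) (w - D) =
      (1 - s) * (1 - t) * dot (p - D) (r - D) + (1 - s) * t * dot (p - D) (r' - D) +
      s * (1 - t) * dot (p' - D) (r - D) + s * t * dot (p' - D) (r' - D).
      by rewrite !dotE; ring.
    move: (dot (p - D) (r - D)) (dot (p - D) (r' - D)) (dot (p' - D) (r - D))
      (dot (p' - D) (r' - D)) => A B C E h4' h3' h2' h1'.
    move: s01 t01 => /andP[s0 s1] /andP[t0 t1].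
    have -> : M = (1 - s) * (1 - t) * M + (1 - s) * t * M + s * (1 - t) * M + s * t * M by ring.
    have s'0 : 0 <= 1 - s by lra. have t'0 : 0 <= 1 - t by lra.
    by rewrite !lerD // ler_wpM2l // mulr_ge0.
  move: E; rewrite ze we !dotE e1 (dotC D e) -/c; nra.
(* The left side of [key] is decreasing in [c] up to [a + b > 1], and at [c = 1] it equals
   [(1 - a) * (1 - b)]. *)
have cE : c = 1 by apply/eqP; rewrite eq_le c1 leNgt /=; apply/negP => cl; nra.
have DE : D = e.
  apply/eqP; rewrite -subr_eq0 -dot_eq0 eq_le dot_ge0 andbT !dotE (dotC D e) -/c e1; lra.
move: key; rewrite cE => key.
have : (1 - a) * (1 - b) = 0 by nra.
move=> /eqP; rewrite mulf_eq0 !subr_eq0 => /orP[] /eqP h.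
  have zD : z = D by rewrite DE ze -h scale1r.
  have [|E|E] := @unit_segpt p p' s p1 p'1; first by rewrite -aa -h expr1n.
    by case/eqP: np; rewrite -zD; exact: E.
  by case/eqP: np'; rewrite -zD; exact: E.
have wD : w = D by rewrite DE we -h scale1r.
have [|E|E] := @unit_segpt r r' t r1 r'1; first by rewrite -bb -h expr1n.
  by case/eqP: nr; rewrite -wD; exact: E.
by case/eqP: nr'; rewrite -wD; exact: E.
Qed.

Lemma sqdist_sym u v : sqdist u v = sqdist v u.
Proof. by rewrite /sqdist -opprB dotNl dotNr opprK. Qed.

Lemma sqdist_via u v x : sqdist u v = sqdist u x + sqdist v x - 2 * dot (u - x) (v - x).
Proof. by rewrite /sqdist !dotE (dotC v u) (dotC x u) (dotC x v); ring. Qed.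

(** Parallel points of the two arcs differ by a factor [k]. If [k < 0], reversing the second arc
    leads to [opposite_arcs] with [D = y - x]. If [k > 0], the first arc lies strictly on the side
    of [y - x] and the second on that of [x - y]. *)
Lemma arcs_disjoint x u u' y w w' s t :
  sqdist u x = 1 -> sqdist u' x = 1 -> sqdist w y = 1 -> sqdist w' y = 1 ->
  sqdist u u' <= 1 -> sqdist w w' <= 1 ->
  (forall a b, a \in [:: x; u; u'] -> b \in [:: y; w; w'] -> a != b /\ sqdist a b <= 1) ->
  0 <= s <= 1 -> 0 <= t <= 1 ->
  sqcross (segpt (u - x) (u' - x) s) (segpt (w - y) (w' - y) t) != 0.
Proof.
move=> ux u'x wy w'y uu ww ab s01 t01.
have in1 (c1 c2 c3 : 'rV[R]_3) : c1 \in [:: c1; c2; c3] by rewrite inE eqxx.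
have in2 (c1 c2 c3 : 'rV[R]_3) : c2 \in [:: c1; c2; c3] by rewrite !inE eqxx orbT.
have in3 (c1 c2 c3 : 'rV[R]_3) : c3 \in [:: c1; c2; c3] by rewrite !inE eqxx !orbT.
have pp : 1 <= 2 * dot (u - x) (u' - x).
  by move: uu; rewrite (sqdist_via u u' x) ux u'x; lra.
have rr : 1 <= 2 * dot (w - y) (w' - y).
  by move: ww; rewrite (sqdist_via w w' y) wy w'y; lra.
have z0 : segpt (u - x) (u' - x) s != 0.
  by rewrite -dot_eq0 gt_eqF //; have /andP[] := segpt_norm_bounds ux u'x pp s01; lra.
have w0 : segpt (w - y) (w' - y) t != 0.
  by rewrite -dot_eq0 gt_eqF //; have /andP[] := segpt_norm_bounds wy w'y rr t01; lra.
apply/eqP => /(sqcross_eq0 z0); move: (_ / _) => k zE.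
have xy : 0 < sqdist x y.
  by rewrite lt_neqAle dot_ge0 andbT eq_sym dot_eq0 subr_eq0; case: (ab x y).
move: s01 t01 => s01 t01; have [/andP[s0 s1] /andP[t0 t1]] := (s01, t01).
have [k0|k0|k0] := ltgtP k 0; last by rewrite zE k0 scale0r eqxx in w0.
- apply: (@opposite_arcs (u - x) (u' - x) (y - w) (y - w') (y - x) s t (- k)) => //;
    rewrite -?/(sqdist _ _) ?(sqdist_sym y) //.
  + by rewrite -(opprB w) -(opprB w') dotNl dotNr opprK.
  + by case: (ab x y).
  + rewrite /sqdist (_ : _ - _ = u - w); first by case: (ab u w).
    by apply/rowP => i; rewrite !mxE; ring.
  + rewrite /sqdist (_ : _ - _ = u - w'); first by case: (ab u w').
    by apply/rowP => i; rewrite !mxE; ring.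
  + rewrite /sqdist (_ : _ - _ = u' - w); first by case: (ab u' w).
    by apply/rowP => i; rewrite !mxE; ring.
  + rewrite /sqdist (_ : _ - _ = u' - w'); first by case: (ab u' w').
    by apply/rowP => i; rewrite !mxE; ring.
  + by rewrite (inj_eq (addIr _)) eq_sym; case: (ab u y).
  + by rewrite (inj_eq (addIr _)) eq_sym; case: (ab u' y).
  + by rewrite (inj_eq (addrI _)) eqr_opp; case: (ab x w).
  + by rewrite (inj_eq (addrI _)) eqr_opp; case: (ab x w').
  + by rewrite oppr_gt0.
  + by rewrite scaleNr -zE; apply/rowP => i; rewrite !mxE; ring.
have side a b c : sqdist a b = 1 -> sqdist a c <= 1 -> sqdist b c <= 1 -> 0 < sqdist b c ->
    0 < dot (a - b) (c - b).
  by move=> ab1; rewrite (sqdist_via a c b) ab1 (sqdist_sym c b) => *; lra.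
have zD : 0 < dot (segpt (u - x) (u' - x) s) (y - x).
  have d1 : 0 < dot (u - x) (y - x) by apply: side => //; case: (ab u y); case: (ab x y).
  have d2 : 0 < dot (u' - x) (y - x) by apply: side => //; case: (ab u' y); case: (ab x y).
  rewrite segpt_dot; move: (dot (u - x) _) (dot (u' - x) _) d1 d2 => A B A0 B0.
  by have [->|sn] := eqVneq s 0; [lra | have : 0 < s; [rewrite lt_neqAle eq_sym sn|nra]].
have wD : 0 < dot (segpt (w - y) (w' - y) t) (x - y).
  have d1 : 0 < dot (w - y) (x - y).
    by apply: side; rewrite // sqdist_sym //; case: (ab x w); case: (ab x y).
  have d2 : 0 < dot (w' - y) (x - y).
    by apply: side; rewrite // sqdist_sym //; case: (ab x w'); case: (ab x y).
  rewrite segpt_dot; move: (dot (w - y) _) (dot (w' - y) _) d1 d2 => A B A0 B0.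
  by have [->|tn] := eqVneq t 0; [lra | have : 0 < t; [rewrite lt_neqAle eq_sym tn|nra]].
by move: wD; rewrite zE dotZl -(opprB y x) dotNr; nra.
Qed.

End Arcs.

Theorem odd_closed_walks_meet (R : realType) (a b : nat -> 'rV[R]_3) m n :
  odd m -> odd n ->
  (forall i, a (i + m)%N = a i) -> (forall i, b (i + n)%N = b i) ->
  (forall i, sqdist (a i) (a i.+1) = 1) -> (forall i, sqdist (b i) (b i.+1) = 1) ->
  (forall i j, sqdist (a i) (a j) <= 1) -> (forall i j, sqdist (b i) (b j) <= 1) ->
  (forall i j, sqdist (a i) (b j) <= 1) ->
  exists i j, a i = b j.
Proof.
move=> om on ap bp a1 b1 aa bb ab.
have gt1 (c : nat -> 'rV[R]_3) p : odd p -> (forall i, c (i + p)%N = c i) ->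
    (forall i, sqdist (c i) (c i.+1) = 1) -> (1 < p)%N.
  case: p => [|[|p]] // _ cp c1; have := c1 0%N.
  by rewrite -(cp 0%N) addn1 /sqdist subrr /dot !mxE !mulr0 !addr0 => /esym/eqP; rewrite oner_eq0.
(* The alternating signs make consecutive vectors, up to a common sign, the edges leaving [c i.+1];
   an odd period makes the polygon antipodal. *)
pose E (c : nat -> 'rV[R]_3) i := (-1) ^+ i *: (c i.+1 - c i).
have EN (c : nat -> 'rV[R]_3) p : odd p -> (forall i, c (i + p)%N = c i) -> E c p = - E c 0%N.
  by move=> op cp; rewrite /E -signr_odd op -(cp 1%N) -(cp 0%N) add0n add1n !scale1r expr1 scaleN1r.
have ES (c : nat -> 'rV[R]_3) i s : segpt (E c i) (E c i.+1) s =
    (-1) ^+ i.+1 *: segpt (c i - c i.+1) (c i.+2 - c i.+1) s.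
  by apply/rowP => k; rewrite !mxE !exprS; ring.
have [i [j [s [t [_ _ s01 t01]]]]] :=
  antipodal_polygons_meet (gt1 _ _ om ap a1) (gt1 _ _ on bp b1) (EN _ _ om ap) (EN _ _ on bp).
rewrite !ES sqcrossZ exprMn -!exprM !(mulnC _ 2) !exprM sqrrN !expr1n !mul1r => /eqP st0.
case: (pselect (exists i j, a i = b j)) => // no; exfalso; move: st0; apply/negP.
apply: arcs_disjoint; rewrite // 1?sqdist_sym //.
move=> u v ua vb; split.
  apply/eqP => uv; apply: no; move: ua vb; rewrite uv !inE.
  by case/or3P => /eqP -> /or3P[] /eqP h; [exists i.+1, j.+1|exists i.+1, j|exists i.+1, j.+2
    |exists i, j.+1|exists i, j|exists i, j.+2|exists i.+2, j.+1|exists i.+2, j|exists i.+2, j.+2].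
by move: ua vb; rewrite !inE => /or3P[] /eqP -> /or3P[] /eqP ->.
Qed.

(** * Three-distance sets *)

Local Open Scope classical_set_scope.
Local Open Scope card_scope.

Lemma edistE (R : realType) (P Q : 'rV[R]_3) : edist P Q = Num.sqrt (sqdist P Q).
Proof. by rewrite /edist sum3 /sqdist /dot !mxE. Qed.

Lemma edist_gt0 (R : realType) (P Q : 'rV[R]_3) : P != Q -> 0 < edist P Q.
Proof.
by move=> PQ; rewrite edistE sqrtr_gt0 lt_neqAle eq_sym dot_ge0 dot_eq0 subr_eq0 PQ.
Qed.

Lemma edistC (R : realType) (P Q : 'rV[R]_3) : edist P Q = edist Q P.
Proof. by rewrite !edistE sqdist_sym. Qed.

Lemma diameter_graph_bipartite (R : realType) (V : finType) (P : V -> 'rV[R]_3)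
    (D : R) (A : {set V}) :
  injective P -> 0 < D -> (forall i j, edist (P i) (P j) <= D) ->
  let e := [rel i j | edist (P i) (P j) == D] in
  bipartite e A \/ bipartite e (~: A).
Proof.
move=> Pinj D0 Dmax e.
have esym : symmetric e by move=> i j; rewrite /= edistC.
have [|nA] := pselect (bipartite e A); first by left.
have [|nB] := pselect (bipartite e (~: A)); first by right.
have [a [m [om am]]] := odd_closed_walk esym nA.
have [b [n [on bn]]] := odd_closed_walk esym nB.
pose Q i := D^-1 *: P i.
have QD i j : sqdist (Q i) (Q j) = (edist (P i) (P j) / D) ^+ 2.
  rewrite edistE expr_div_n sqr_sqrtr ?dot_ge0 // /sqdist /Q -scalerBr dotZl dotZr.
  by field; rewrite gt_eqF.
have Qe i j : e i j -> sqdist (Q i) (Q j) = 1.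
  by move=> /eqP eij; rewrite QD eij divff ?gt_eqF // expr1n.
have Q1 i j : sqdist (Q i) (Q j) <= 1.
  have E0 : 0 <= edist (P i) (P j) by rewrite edistE sqrtr_ge0.
  rewrite QD expr_le1 ?divr_ge0 ?(ltW D0) //.
  by rewrite ler_pdivrMr // mul1r.
have [|||||||i [j]] := @odd_closed_walks_meet R (Q \o a) (Q \o b) m n om on.
- by move=> i /=; have [_ _ ->] := am i.
- by move=> i /=; have [_ _ ->] := bn i.
- by move=> i; apply: Qe; have [] := am i.
- by move=> i; apply: Qe; have [] := bn i.
- by move=> i j; apply: Q1.
- by move=> i j; apply: Q1.
- by move=> i j; apply: Q1.
move=> /= /(scalerI (invr_neq0 (lt0r_neq0 D0))) /Pinj ab.
by have [aA _ _] := am i; have [] := bn j; rewrite -ab inE aA.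
Qed.

(** The four differences from [P 0] are linearly dependent. Their Gram matrix is [d ^+ 2 / 2] times
    identity plus all-ones, so every coefficient of a relation is minus their sum; adding the four
    equations makes this sum 0. *)
Lemma not_equidistant5 (R : realType) (P : nat -> 'rV[R]_3) (d : R) : 0 < d ->
  ~ (forall i j, (i < 5)%N -> (j < 5)%N -> i != j -> edist (P i) (P j) = d).
Proof.
move=> d0 Pd.
have P2 i j : (i < 5)%N -> (j < 5)%N -> i != j -> sqdist (P i) (P j) = d ^+ 2.
  by move=> i5 j5 ij; rewrite -(Pd i j) // edistE sqr_sqrtr // dot_ge0.
pose M : 'M[R]_(4, 3) := \matrix_(i < 4) (P i.+1 - P 0%N).
have l5 (i : 'I_4) : (i.+1 < 5)%N by rewrite ltnS.
have : kermx M != 0.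
  rewrite -mxrank_eq0 mxrank_ker subn_eq0 -ltnNge.
  by apply: leq_ltn_trans (rank_leq_col M) _.
case/rowV0Pn => u /sub_kermxP uM u0.
have uE j : u 0 j = - \sum_i u 0 i.
  have : dot (u *m M) (P j.+1 - P 0%N) = 0 by rewrite uM /dot !mxE; ring.
  rewrite mulmx_sum_row.
  have -> : dot (\sum_i u 0 i *: row i M) (P j.+1 - P 0%N) =
      \sum_i u 0 i * dot (P i.+1 - P 0%N) (P j.+1 - P 0%N).
    elim/big_rec2: _ => [|i x y _ <-]; first by rewrite /dot !mxE; ring.
    by rewrite dotDl dotZl rowK.
  have -> : \sum_i u 0 i * dot (P i.+1 - P 0%N) (P j.+1 - P 0%N) =
      d ^+ 2 / 2 * (u 0 j + \sum_i u 0 i).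
    rewrite !(bigD1 j (P := predT)) //= -/(sqdist _ _) (P2 j.+1 0%N) ?l5 //.
    rewrite (eq_bigr (fun i => d ^+ 2 / 2 * u 0 i)) => [|i ij].
      by rewrite -mulr_sumr; move: (\sum_(i | _) _) => S; field.
    have := sqdist_via (P i.+1) (P j.+1) (P 0%N).
    rewrite (P2 i.+1 0%N) ?(P2 j.+1 0%N) ?(P2 i.+1 j.+1) ?l5 ?eqSS // => h.
    by rewrite mulrC; congr (_ * _); lra.
  move/eqP; rewrite mulf_eq0 gt_eqF ?divr_gt0 ?exprn_gt0 //= addr_eq0.
  by move/eqP.
case/negP: u0; apply/eqP/rowP => j; rewrite mxE uE.
have : \sum_i u 0 i = \sum_(i < 4) (- \sum_i u 0 i) by apply: eq_bigr => i _.
by rewrite sumr_const card_ord -mulr_natr; lra.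
Qed.

Lemma card_eq_enum (T : Type) (X : set T) n : X #= `I_n ->
  exists f : 'I_n -> T, injective f /\ forall x, X x <-> exists i, f i = x.
Proof.
case/card_set_bijP => g [gX ginj gsurj].
have /choice[f fP] : forall i : 'I_n, exists x, X x /\ g x = i.
  by move=> i; have [x] := gsurj i (ltn_ord i); exists x.
exists f; split=> [i j fij|x]; first by apply: ord_inj; rewrite -(fP i).2 fij (fP j).2.
split=> [Xx|[i <-]]; last by case: (fP i).
exists (Ordinal (gX _ Xx)); apply: ginj; rewrite ?inE //; first by case: (fP (Ordinal (gX _ Xx))).
by rewrite (fP _).2.
Qed.

Theorem theorem1p4 (R : realType) (X : set 'rV[R]_3)
    (X_3dist : distance_set 3 X) (X_card : X #= `I_12) :
  exists Y : set 'rV[R]_3, [/\ Y `<=` X, Y #= `I_5 & distance_set 2 Y].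
Proof.
have [P [Pinj PXE]] := card_eq_enum X_card.
have [D [d1 [d2 [d12 dD dX]]]] : exists D d1 d2, [/\ d1 <> d2,
    forall r, distances X r -> r <= D &
    forall r, distances X r -> [\/ r = D, r = d1 | r = d2]].
  have [g [ginj gE]] := card_eq_enum X_3dist.
  have gd i j : i != j -> g i <> g j by move=> /eqP ij /ginj.
  have {}gE r : distances X r -> [\/ r = g 0, r = g 1 | r = g 2%:R].
    case/gE => i <-; have : [\/ i = 0, i = 1 | i = 2%:R].
      by case: i => [[|[|[|]]]] // h; [apply: Or31|apply: Or32|apply: Or33]; apply: val_inj.
    by case=> ->; [apply: Or31|apply: Or32|apply: Or33].
  have := gd 0 1 isT; have := gd 0 2%:R isT; have := gd 1 2%:R isT.
  move: gE; move: (g 0) (g 1) (g 2%:R) => x y z rE yz xz xy.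
  have [yx|xy'] := leP y x.
    have [zx|xz'] := leP z x; [exists x, y, z | exists z, x, y]; split => //.
    - by move=> r /rE[] ->.
    - by move=> r /rE[] -> //; lra.
    - by move=> r /rE[] ->; [apply: Or32|apply: Or33|apply: Or31].
  have [zy|yz'] := leP z y; [exists y, x, z | exists z, x, y]; split => //.
  - by move=> r /rE[] ->; lra.
  - by move=> r /rE[] ->; [apply: Or32|apply: Or31|apply: Or33].
  - by move=> r /rE[] ->; lra.
  - by move=> r /rE[] ->; [apply: Or32|apply: Or33|apply: Or31].
have PX i : X (P i) by apply/PXE; exists i.
have Pdist i j : i != j -> distances X (edist (P i) (P j)).
  by move=> ij; exists (P i), (P j); split=> // /Pinj /eqP; rewrite (negPf ij).
have D0 : 0 < D.
  by apply: lt_le_trans (dD _ (Pdist 0 1 isT)); apply: edist_gt0; rewrite inj_eq.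
have Dmax i j : edist (P i) (P j) <= D.
  have [->|ij] := eqVneq i j; last exact/dD/Pdist.
  by rewrite edistE /sqdist subrr /dot !mxE !mulr0 !addr0 sqrtr0 ltW.
pose e := [rel i j : 'I_12 | edist (P i) (P j) == D].
have [S iS S5] : exists2 S : {set 'I_12}, indep e S & (5 <= #|S|)%N.
  apply: exists_indep5.
  - by move=> i j; rewrite /= edistC.
  - by move=> i /=; rewrite edistE /sqdist subrr /dot !mxE !mulr0 !addr0 sqrtr0 lt_eqF.
  - by rewrite card_ord.
  - by move=> A; apply: diameter_graph_bipartite.
(* The default [ord0] is never reached for [k < 5], as [S] has at least 5 elements. *)
pose h k := P (nth ord0 (enum S) k).
have hS k : (k < 5)%N -> nth ord0 (enum S) k \in S.
  by move=> k5; rewrite -mem_enum mem_nth // -cardE (leq_trans k5).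
have hinj k l : (k < 5)%N -> (l < 5)%N -> k != l -> h k <> h l.
  move=> k5 l5 kl /Pinj /eqP; rewrite nth_uniq ?enum_uniq ?(negPf kl) // -cardE.
    exact: leq_trans k5 S5.
  exact: leq_trans l5 S5.
have hdist r : distances (h @` `I_5) r ->
    exists k l, [/\ (k < 5)%N, (l < 5)%N, k != l & r = edist (h k) (h l)].
  case=> _ [_ [[k k5 <-] [l l5 <-] kl ->]]; exists k, l; split => //.
  by apply/eqP => klE; apply: kl; rewrite klE.
have hd k l : (k < 5)%N -> (l < 5)%N -> k != l ->
    edist (h k) (h l) = d1 \/ edist (h k) (h l) = d2.
  move=> k5 l5 kl.
  have /Pdist/dX[DE| |] : nth ord0 (enum S) k != nth ord0 (enum S) l.
  - by apply/eqP => E; apply: (hinj k l k5 l5 kl); rewrite /h E.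
  - by have := iS _ _ (hS _ k5) (hS _ l5); rewrite /= DE eqxx.
  - by left.
  - by right.
(* If one of two admissible values did not occur, the five points would be equidistant. *)
have both (x y : R) : (forall k l, (k < 5)%N -> (l < 5)%N -> k != l ->
    edist (h k) (h l) = x \/ edist (h k) (h l) = y) -> distances (h @` `I_5) x.
  move=> xy; apply: contrapT => nx; apply: (@not_equidistant5 R h y).
    have [xE|<-] := xy 0%N 1%N isT isT isT.
      case: nx; exists (h 0%N), (h 1%N).
      by split=> //; [exists 0%N | exists 1%N | apply: hinj].
    by apply: edist_gt0; apply/eqP; apply: hinj.
  move=> k l k5 l5 kl; have [xE|//] := xy k l k5 l5 kl.
  case: nx; exists (h k), (h l).
  by split=> //; apply: hinj.
exists (h @` `I_5); split.
- by move=> _ [k _ <-]; apply: PX.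
- apply: inj_card_eq => k l; rewrite !inE /= => k5 l5 hkl.
  by apply/eqP/negPn/negP => kl; exact: hinj hkl.
- rewrite /distance_set.
  have -> : distances (h @` `I_5) = (fun k => if k == 0%N then d1 else d2) @` `I_2.
    apply/seteqP; split=> r.
      case/hdist => k [l [k5 l5 kl ->]]; have [->|->] := hd k l k5 l5 kl.
        by exists 0%N.
      by exists 1%N.
    case=> -[|[|//]] _ <- /=; first exact: (both _ _ hd).
    by apply: (both d2 d1) => k l k5 l5 kl; apply/or_comm/hd.
  apply: inj_card_eq => k l; rewrite !inE /= => k2 l2.
  by case: k k2 => [|[|//]] _; case: l l2 => [|[|//]] _ //= E; case: d12.
Qed.
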